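(* Let $\mathcal{A}$ be an affine hyperplane arrangement in $\mathbb{R}^d$. For each $j\in\{0,\ldots,d\}$ write its $j$-th level characteristic polynomial in the form $\chi_{\mathcal{A},j}(t)=\sum_{k=0}^j(-1)^{j-k}a_{kj}t^k$. Then, for every $j\in\{0,\ldots,d\}$ and $k\in\{0,\ldots,j\}$, $$\sum_{P\in\mathcal{R}_j(\mathcal{A})}\ \sum_{F\in\mathcal{F}_k(P)}\mathbf{1}_{F+N_F(P)}(x)=a_{kj}\qquad\text{for all }x\in\mathbb{R}^d\setminus E_{kj},$$ where $$E_{kj}=\bigcup_{P\in\mathcal{R}_j(\mathcal{A})}\ \bigcup_{F\in\mathcal{F}_k(P)}\partial\bigl(F+N_F(P)\bigr).$$
   Context: An affine hyperplane arrangement $\mathcal{A}=\{H_1,\ldots,H_m\}$ in $\mathbb{R}^d$ (or, analogously, in an affine subspace) is a finite collection of pairwise distinct affine hyperplanes. The closures of the connected components of $\mathbb{R}^d\setminus\bigcup_{i=1}^m H_i$ are called (closed) chambers; $\mathcal{R}(\mathcal{A})$ is the set of all closed chambers. Each chamber is a polyhedral set, i.e. an intersection of finitely many closed half-spaces. For a polyhedral set $P\subset\mathbb{R}^d$, $\mathcal{F}_k(P)$ is the set of its $k$-dimensional (nonempty) faces; $P$ is a face of itself. For $j\in\{0,\ldots,d\}$, $\mathcal{R}_j(\mathcal{A})=\bigcup_{P\in\mathcal{R}(\mathcal{A})}\mathcal{F}_j(P)$ is the set (without repetitions) of all $j$-dimensional faces of all chambers. $\mathcal{L}(\mathcal{A})$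 is the set of all non-empty intersections of hyperplanes from $\mathcal{A}$, including $\mathbb{R}^d$ as the empty intersection; $\mathcal{L}_j(\mathcal{A})$ is the set of $j$-dimensional elements of $\mathcal{L}(\mathcal{A})$. For $L\in\mathcal{L}(\mathcal{A})$ the restriction of $\mathcal{A}$ to $L$ is the affine hyperplane arrangement in the ambient space $L$ given by $\mathcal{A}^L=\{H\cap L:\ H\in\mathcal{A},\ H\cap L\ne L,\ H\cap L\neq\varnothing\}$ (a set: coinciding intersections are listed once). The characteristic polynomial of an arrangement $\mathcal{A}'$ in an ambient affine space $V$ is $$\chi_{\mathcal{A}'}(t)=\sum_{\mathcal{B}\subset\mathcal{A}':\ \bigcap_{H\in\mathcal{B}}H\neq\varnothing}(-1)^{\#\mathcal{B}}\,t^{\dim\left(\bigcap_{H\in\mathcal{B}}H\right)},$$ where the intersection for $\mathcal{B}=\varnothing$ is $V$. The $j$-th level characteristic polynomial of $\mathcal{A}$ is $\chi_{\mathcal{A},j}(t)=\sum_{L\in\mathcal{L}_j(\mathcal{A})}\chi_{\mathcal{A}^L}(t)$, and the numbers $a_{kj}$ are defined by $\chi_{\mathcal{A},j}(t)=\sum_{k=0}^j(-1)^{j-k}a_{kj}t^k$. The relative interior $\operatorname{relint}F$ of a face $F$ consists of all points of $F$ not belonging to a face of strictly smaller dimension. The tangent cone of $P$ at a face $F$ is $T_F(P)=\{u\in\mathbb{R}^d:\exists\,\delta>0:\ f_0+\delta u\in P\}$, where $f_0\in\operatorname{relint}F$ is arbitrary (the result does not depend on $f_0$). The polar cone of a polyhedral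 cone $C$ is $C^\circ=\{z\in\mathbb{R}^d:\langle z,y\rangle\le 0\text{ for all }y\in C\}$. The normal cone of $P$ at $F$, taken in the ambient space $\mathbb{R}^d$ even when $P$ is lower-dimensional, is $N_F(P)=(T_F(P))^\circ$. The sum $F+N_F(P)$ is the Minkowski sum, $\mathbf{1}_A$ is the indicator function of $A$, and $\partial A=A\setminus\operatorname{int}A$ is the boundary of $A$, where $\operatorname{int}$ denotes the interior in $\mathbb{R}^d$. *)

(* Defs.v *)
From HB Require Import structures.
From mathcomp Require Import all_boot all_order all_algebra finmap.
From mathcomp Require Import all_classical all_reals all_analysis.

Set Implicit Arguments.
Unset Strict Implicit.
Unset Printing Implicit Defensive.

Import Order.TTheory GRing.Theory Num.Theory.
Import numFieldNormedType.Exports.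

Local Open Scope fset_scope.
Local Open Scope classical_set_scope.
Local Open Scope ring_scope.

Section Euclidean.
Variables (R : realType) (d : nat).
Local Notation V := 'rV[R]_d.

Definition dotv (u v : V) : R := \sum_(i < d) u 0 i * v 0 i.

Definition affine_subspace (S : set V) : Prop :=
  exists (x0 : V) (U : {vspace V}), S = [set x | x - x0 \in U].

Definition affine_hull (S : set V) : set V := smallest affine_subspace S.

(* The dimension of the affine hull; only meaningful for nonempty S. *)
Definition affdim (S : set V) : nat :=
  xget 0%N [set k | exists (x0 : V) (U : {vspace V}),
    affine_hull S = [set x | x - x0 \in U] /\ \dim U = k].

Definition hyperplane (H : set V) : Prop :=
  exists (a : V) (b : R), a != 0 /\ H = [set x | dotv a x = b].

(* Taking a = 0 and b = 0 shows that P is a face of itself; the other faces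
   are the intersections of P with its supporting hyperplanes. *)
Definition is_face (P F : set V) : Prop :=
  F !=set0 /\
  exists (a : V) (b : R),
    (forall x, P x -> dotv a x <= b) /\ F = P `&` [set x | dotv a x = b].

Definition faces (k : nat) (P : set V) : set (set V) :=
  [set F | is_face P F /\ affdim F = k].

Definition relint (F : set V) : set V :=
  [set x | F x /\ forall G, is_face F G -> (affdim G < affdim F)%N -> ~ G x].

(* For a face F of a polyhedral set P, the condition on u does not depend on
   the choice of f0 in the (nonempty) relative interior of F. *)
Definition tangent_cone (F P : set V) : set V :=
  [set u | exists2 f0, relint F f0 &
    exists delta : R, 0 < delta /\ P (f0 + delta *: u)].

Definition polar_cone (C : set V) : set V :=
  [set z | forall y, C y -> dotv z y <= 0].

Definition normal_cone (F P : set V) : set V := polar_cone (tangent_cone F P).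

Definition minkowski_sum (S T : set V) : set V :=
  [set x + y | x in S & y in T].

Definition bdry (S : set V) : set V := S `\` interior S.

(* An arrangement is a finite set of point sets, so that its members are
   pairwise distinct as subsets of the space. *)
Definition is_arrangement (A : {fset set V}) : Prop :=
  forall H, H \in A -> hyperplane H.

(* The intersection of the members of B inside the ambient space L. *)
Definition inter_in (L : set V) (B : {fset set V}) : set V :=
  L `&` \bigcap_(H in [set` B]) H.

Definition complement_of (A : {fset set V}) : set V :=
  ~` \bigcup_(H in [set` A]) H.

Definition chambers (A : {fset set V}) : set (set V) :=
  [set closure (connected_component (complement_of A) x)
     | x in complement_of A].

Definition chamber_faces (A : {fset set V}) (j : nat) : set (set V) :=
  \bigcup_(P in chambers A) faces j P.

Definition flats (A : {fset set V}) : {fset set V} :=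
  [fset L in [fset inter_in setT B | B in fpowerset A] | L != set0].

Definition flats_dim (A : {fset set V}) (j : nat) : {fset set V} :=
  [fset L in flats A | affdim L == j].

Definition restriction (A : {fset set V}) (L : set V) : {fset set V} :=
  [fset G in [fset H `&` L | H in A] | (G != L) && (G != set0)].

Definition charpoly (L : set V) (A : {fset set V}) : {poly int} :=
  \sum_(B <- fpowerset A | inter_in L B != set0)
     (-1) ^+ #|` B| *: 'X^(affdim (inter_in L B)).

Definition level_charpoly (A : {fset set V}) (j : nat) : {poly int} :=
  \sum_(L <- flats_dim A j) charpoly L (restriction A L).

Definition exceptional_set (A : {fset set V}) (k j : nat) : set V :=
  \bigcup_(P in chamber_faces A j)
    \bigcup_(F in faces k P) bdry (minkowski_sum F (normal_cone F P)).

End Euclidean.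

(* Main.v *)
Require Import Defs.
From HB Require Import structures.
From mathcomp Require Import all_boot all_order all_algebra finmap.
From mathcomp Require Import all_classical all_reals all_analysis.
From mathcomp Require Import ring lra.

Set Implicit Arguments.
Unset Strict Implicit.
Unset Printing Implicit Defensive.

Import Order.TTheory GRing.Theory Num.Theory.
Import numFieldNormedType.Exports.

Local Open Scope fset_scope.
Local Open Scope classical_set_scope.
Local Open Scope ring_scope.

(** The sum counts pairs (P, F), where P is a [j]-dimensional face of a chamber
    and F is a [k]-dimensional face of P with [x] in F + N_F(P).  The proof has
    three ingredients.

    Metric projection.  If [x] lies in F + N_F(P) then the point f of P nearest
    to [x] lies in F.  Say that [x] is in general position ([genpos]) when its
    orthogonal projection to a flat M lies on a hyperplane of the arrangement
    only if that hyperplane contains M.  For such an [x] the point f avoids every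
    proper face of F, so F is the face of P carrying f in its relative interior,
    and conversely this face does contribute ([minkowski_generic]).  The sum is
    therefore the number of [j]-dimensional P whose point nearest to [x] lies in
    the relative interior of a [k]-dimensional face ([sum_faces]).

    Deletion and restriction.  The [j]-dimensional faces of chambers are the
    closed cells cut out, in the [j]-dimensional flats L, by the hyperplanes
    that do not contain L ([sum_cells]).  Fix L and add one more
    hyperplane H.  A cell C cut by H into two halves has its nearest point q in
    one half, whose nearest point is again q; the nearest point of the other
    half lies on H and is the one of the cell C meet H of the restriction to H
    ([nearest_cross]).  General position ensures that the dimension of the face
    carrying q is not changed by H.  So the number of cells of L whose nearest
    point lies in a [k]-dimensional face satisfies
    N(A + H, L) = N(A, L) + N(A, L meet H) ([hits_split]).  This is, up to the
    sign (-1)^(dim L - k), the deletion-restriction recursion of the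
    characteristic polynomial, and the two sides agree for the empty arrangement
    ([lchi_hits]).  Summation over L identifies the count with a_kj
    ([level_charpoly_hits]).

    Perturbation.  The sets F + N_F(P) are closed and finitely many, so off their
    boundaries all indicators are locally constant ([near_indicators]).  The
    points that fail to be in general position lie on finitely many hyperplanes
    ([genpos_dense]), so every [x] off the exceptional set may be replaced by a
    point in general position without changing the sum. *)

(** * The Euclidean inner product *)

Section Affine.
Variables (R : realType) (d : nat).
Local Notation V := 'rV[R]_d.
Implicit Types (a x y z u v w p q : V) (c t : R) (U W : {vspace V}) (S C L H : set V).

Lemma dotvC u v : dotv u v = dotv v u.
Proof. by apply: eq_bigr => i _; rewrite mulrC. Qed.

Lemma dotvDl u v w : dotv (u + v) w = dotv u w + dotv v w.
Proof. by rewrite -big_split; apply: eq_bigr => i _; rewrite mxE mulrDl. Qed.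

Lemma dotvZl c u w : dotv (c *: u) w = c * dotv u w.
Proof. by rewrite mulr_sumr; apply: eq_bigr => i _; rewrite mxE mulrA. Qed.

Lemma dotvNl u w : dotv (- u) w = - dotv u w.
Proof. by rewrite -scaleN1r dotvZl mulN1r. Qed.

Lemma dotvBl u v w : dotv (u - v) w = dotv u w - dotv v w.
Proof. by rewrite dotvDl dotvNl. Qed.

Lemma dotvDr u v w : dotv w (u + v) = dotv w u + dotv w v.
Proof. by rewrite dotvC dotvDl !(dotvC w). Qed.

Lemma dotvZr c u w : dotv w (c *: u) = c * dotv w u.
Proof. by rewrite dotvC dotvZl (dotvC w). Qed.

Lemma dotvNr u w : dotv w (- u) = - dotv w u.
Proof. by rewrite dotvC dotvNl (dotvC w). Qed.

Lemma dotvBr u v w : dotv w (u - v) = dotv w u - dotv w v.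
Proof. by rewrite dotvDr dotvNr. Qed.

Lemma dotv0l w : dotv 0 w = 0.
Proof. by rewrite -(scale0r (0 : V)) dotvZl mul0r. Qed.

Lemma dotv0r w : dotv w 0 = 0.
Proof. by rewrite dotvC dotv0l. Qed.

Definition dotvE := (dotvDl, dotvDr, dotvNl, dotvNr, dotvZl, dotvZr).

Lemma dotv_ge0 v : 0 <= dotv v v.
Proof. by apply: sumr_ge0 => i _; rewrite -expr2 sqr_ge0. Qed.

Lemma dotv_eq0 v : (dotv v v == 0) = (v == 0).
Proof.
apply/eqP/eqP=> [/psumr_eq0P v0|->]; last exact: dotv0l.
apply/rowP => i; rewrite mxE; apply/eqP; rewrite -sqrf_eq0 expr2.
by rewrite v0// => j _; rewrite -expr2 sqr_ge0.
Qed.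

Lemma dotv_continuous a : continuous (dotv a).
Proof.
have add_c : continuous (fun z : R * R => z.1 + z.2) by exact: add_continuous.
apply: (continuous_big add_c) => i _ x.
apply: (@continuousM _ _ (fun=> a 0 i) (fun x : V => x 0 i)).
  exact: cst_continuous.
exact: coord_continuous.
Qed.

(** * Affine subspaces *)

Definition flat p U : set V := [set x | x - p \in U].

Lemma flatP p U : affine_subspace (flat p U).
Proof. by exists p, U. Qed.

Lemma flat_self p U : flat p U p.
Proof. by rewrite /flat/= subrr mem0v. Qed.

Lemma flat_rebase p q U : flat p U q -> flat p U = flat q U.
Proof.
rewrite /flat /= => pq; apply/seteqP; split=> x /= xp.
  have -> : x - q = (x - p) - (q - p) by rewrite opprB addrA subrK.
  by rewrite memvB.
have -> : x - p = (x - q) + (q - p) by rewrite addrA subrK.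
by rewrite memvD.
Qed.

Lemma affine_flat L q : affine_subspace L -> L q -> exists U, L = flat q U.
Proof. by move=> [p [U ->]] Lq; exists U; exact: flat_rebase. Qed.

Lemma flat_sub p q U W : flat p U `<=` flat q W -> (U <= W)%VS.
Proof.
move=> sUW; have pq := sUW _ (flat_self p U).
apply/subvP => u uU; have : flat q W (p + u).
  by apply: sUW; rewrite /flat/= addrC addKr.
rewrite (flat_rebase pq) /flat/= addrC addKr //.
Qed.

Lemma flat_inj p q U W : flat p U = flat q W -> U = W.
Proof.
move=> e; apply/eqP; rewrite eqEsubv; apply/andP; split.
  by apply: (@flat_sub p q); rewrite e.
by apply: (@flat_sub q p); rewrite e.
Qed.

Lemma affine_line L x y t : affine_subspace L -> L x -> L y ->
  L (x + t *: (y - x)).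
Proof.
move=> aL Lx; have [U ->] := affine_flat aL Lx.
by rewrite /flat/= => yx; rewrite addrC addKr memvZ.
Qed.

Lemma affdimE S p U : affine_hull S = flat p U -> affdim S = \dim U.
Proof.
move=> hS; rewrite /affdim; case: xgetP => [k -> [q [W [e <-]]]|/(_ (\dim U))].
  by rewrite (flat_inj (etrans (esym hS) e)).
by case; exists p, U.
Qed.

(** A relative interior point [p] in the algebraic sense, from which the set can
    be left in every direction of [U], already forces any affine subspace
    containing the set to contain all of [flat p U]. *)
Lemma affine_hull_core S p U : S p -> S `<=` flat p U ->
  (forall u, u \in U -> exists2 e, 0 < e & S (p + e *: u)) ->
  affine_hull S = flat p U.
Proof.
move=> Sp SU core; apply/seteqP; split.
  by apply: smallest_sub => //; exact: flatP.
move=> x /= xp _ [[q [W ->]] SM] /=.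
have [e e0 Se] := core _ xp.
have /= h1 := SM _ Sp; have /= h2 := SM _ Se.
have : e *: (x - p) \in W.
  have -> : e *: (x - p) = (p + e *: (x - p) - q) - (p - q).
    by rewrite opprB addrA subrK addrC addKr.
  by rewrite memvB.
move=> /(memvZ e^-1); rewrite scalerA mulVf ?gt_eqF// scale1r => h.
by rewrite -(subrK p x) -addrA memvD.
Qed.

Lemma affdim_core S p U : S p -> S `<=` flat p U ->
  (forall u, u \in U -> exists2 e, 0 < e & S (p + e *: u)) ->
  affdim S = \dim U.
Proof. by move=> Sp SU h; apply: (affdimE (affine_hull_core Sp SU h)). Qed.

Lemma affdim_flat p U : affdim (flat p U) = \dim U.
Proof.
apply: (@affdim_core _ p) => //; first exact: flat_self.
by move=> u uU; exists 1 => //; rewrite /flat/= scale1r addrC addKr.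
Qed.

(** * Orthogonal projections *)

(** Gram-Schmidt: adjoining [v] to a spanning family adds the component along
    [w], the part of [v] orthogonal to the span of the others. *)
Lemma orth_proj_exists U : exists p : V -> V, forall x,
  p x \in U /\ forall u, u \in U -> dotv (x - p x) u = 0.
Proof.
have [s ->] : exists s, U = span s.
  by exists (vbasis U); rewrite (span_basis (vbasisP U)).
elim: s => [|v s [p ps]].
  exists (fun=> 0) => x; rewrite span_nil mem0v; split=> // u.
  by rewrite memv0 => /eqP ->; rewrite dotv0r.
pose w := v - p v; pose c x := dotv x w / dotv w w.
have ws u : u \in span s -> dotv w u = 0 by case: (ps v) => _; apply.
exists (fun x => p x + c x *: w) => x; rewrite span_cons; split.
  have [px _] := ps x; have [pv _] := ps v.
  apply: memvD; first exact: (subvP (addvSr _ _)).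
  by apply: memvZ; rewrite memv_add ?memv_line// memvN.
move=> _ /memv_addP[_ /vlineP[k ->] [u us ->]].
have [px xp] := ps x; have [pv _] := ps v.
have kv : k *: v + u = k *: w + (k *: p v + u).
  by rewrite addrA -scalerDr subrK.
have ks : k *: p v + u \in span s by rewrite memvD ?memvZ.
rewrite kv; move: (k *: p v + u) ks => {kv}{us}{}u us.
rewrite opprD addrA dotvBl dotvDr (xp u)// addr0 dotvZl dotvDr (ws u)// addr0 !dotvZr.
have -> : dotv (x - p x) w = dotv x w by rewrite [LHS]dotvBl (dotvC (p x)) ws// subr0.
rewrite /c; have [w0|w0] := eqVneq w 0; first by rewrite w0 !dotv0r; lra.
by field; rewrite dotv_eq0.
Qed.

Definition oproj U : V -> V := projT1 (cid (orth_proj_exists U)).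

Lemma oproj_in U x : oproj U x \in U.
Proof. by rewrite /oproj; case: cid => p /= /(_ x) []. Qed.

Lemma oproj_orth U x u : u \in U -> dotv (x - oproj U x) u = 0.
Proof. by rewrite /oproj; case: cid => p /= /(_ x) [_]; apply. Qed.

(** Orthogonal projections are self-adjoint, which turns any affine condition on
    the projection of a point into an affine condition on the point. *)
Lemma oproj_adj U x y : dotv x (oproj U y) = dotv (oproj U x) y.
Proof.
have /eqP := oproj_orth x (oproj_in U y); rewrite dotvBl subr_eq0 => /eqP ->.
have /eqP := oproj_orth y (oproj_in U x).
by rewrite dotvBl subr_eq0 (dotvC y) (dotvC (oproj U y)) => /eqP ->.
Qed.

(** * Nearest points *)

(** For convex [C] this variational inequality says that [q] is the point of [C]
    at minimal distance from [x]. *)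
Definition nearest C x q := C q /\ forall y, C y -> dotv (x - q) (y - q) <= 0.

Lemma nearest_uniq C x q q' : nearest C x q -> nearest C x q' -> q = q'.
Proof.
move=> [Cq h] [Cq' h']; apply/eqP; rewrite -subr_eq0 -dotv_eq0.
have := h _ Cq'; have := h' _ Cq; have := dotv_ge0 (q - q').
rewrite !dotvE !(dotvC q') !(dotvC q) => *; apply/eqP; lra.
Qed.

Lemma nearest_flat p U x q : nearest (flat p U) x q <->
  flat p U q /\ forall u, u \in U -> dotv (x - q) u = 0.
Proof.
split=> [[pq h]|[pq h]]; split=> //.
  move=> u uU; rewrite (flat_rebase pq) in h; apply/eqP; rewrite eq_le.
  have := h (q + u); have := h (q - u).
  rewrite /flat/= ![q + _ - q]addrC !addKr memvN uU dotvNr oppr_le0.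
  by move=> -> // ->.
by move=> y; rewrite (flat_rebase pq) => /h ->.
Qed.

Lemma nearest_oproj p U x : nearest (flat p U) x (p + oproj U (x - p)).
Proof.
apply/nearest_flat; split=> [|u uU].
  by rewrite /flat/= addrC addKr oproj_in.
by rewrite opprD addrA oproj_orth.
Qed.

(** * Hyperplanes *)

(** Hyperplanes are bare point sets; an equation [dotv (hvec H) x = hoff H] is
    chosen for each of them, and [hform H] is the resulting affine form. *)
Definition hvec H : V := (xget (0, 0) [set ab : V * R |
  ab.1 != 0 /\ H = [set x | dotv ab.1 x = ab.2]]).1.

Definition hoff H : R := (xget (0, 0) [set ab : V * R |
  ab.1 != 0 /\ H = [set x | dotv ab.1 x = ab.2]]).2.

Definition hform H x := dotv (hvec H) x - hoff H.

Lemma hvec_neq0 H : hyperplane H -> hvec H != 0.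
Proof.
by move=> [a [b ab]]; rewrite /hvec; case: xgetP => [? _ []|/(_ (a, b))].
Qed.

Lemma hformP H x : hyperplane H -> H x <-> hform H x = 0.
Proof.
move=> [a [b ab]]; rewrite /hform/hvec/hoff.
case: xgetP => [[a' b'] _ /= [_ ->]/=|/(_ (a, b))//].
by split=> [->|/subr0_eq//]; rewrite subrr.
Qed.

Lemma hformD H x u : hform H (x + u) = hform H x + dotv (hvec H) u.
Proof. by rewrite /hform dotvDr addrAC. Qed.

Lemma hform_line H x y t :
  hform H (x + t *: (y - x)) = (1 - t) * hform H x + t * hform H y.
Proof. by rewrite /hform !dotvE; ring. Qed.

Lemma hform_continuous H : continuous (hform H).
Proof.
move=> x; apply: (@continuousB _ _ _ (dotv (hvec H)) (fun=> hoff H)).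
  exact: dotv_continuous.
exact: cst_continuous.
Qed.

(** The linear form [dotv a], with values in row vectors of size one so that its
    kernel is available as a vector subspace. *)
Definition dot_row a v : 'rV[R]_1 := \row_(j < 1) dotv a v.

Lemma dot_row_linear a : linear (dot_row a).
Proof. by move=> c u v; apply/rowP => j; rewrite !mxE dotvDr dotvZr. Qed.

HB.instance Definition _ a := GRing.isLinear.Build R V 'rV[R]_1 *:%R
  (dot_row a) (dot_row_linear a).

Definition hker a : {vspace V} := lker (linfun (dot_row a)).

Lemma mem_hker a v : (v \in hker a) = (dotv a v == 0).
Proof.
rewrite memv_ker lfunE /=; apply/eqP/eqP => [/rowP/(_ 0)|h].
  by rewrite !mxE.
by apply/rowP => j; rewrite !mxE.
Qed.

Lemma dim_capv_hker U a u : u \in U -> dotv a u != 0 ->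
  \dim U = (\dim (U :&: hker a)).+1.
Proof.
move=> uU au; set f := linfun (dot_row a).
rewrite -[LHS](limg_ker_dim f) -[RHS]addn1; congr (_ + _)%N.
apply/eqP; rewrite eqn_leq; apply/andP; split.
  by rewrite (leq_trans (dimvS (subvf _)))// dimvf /dim/= muln1.
rewrite lt0n dimv_eq0; apply/eqP => h.
have := memv_img f uU; rewrite h memv0 lfunE/= => /eqP/rowP/(_ 0).
by rewrite !mxE => /eqP; rewrite (negPf au).
Qed.

Lemma flat_capH p U H : hyperplane H -> H p ->
  flat p U `&` H = flat p (U :&: hker (hvec H)).
Proof.
move=> hH Hp; apply/seteqP; split=> y; rewrite /flat/= memv_cap mem_hker.
  move=> [-> /(hformP _ hH)]; have /(hformP _ hH) := Hp; rewrite /hform.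
  by rewrite dotvBr => h1 h2; apply/eqP; lra.
move=> /andP[yU /eqP]; rewrite dotvBr => h; split=> //; apply/(hformP _ hH).
have /(hformP _ hH) := Hp; rewrite /hform; lra.
Qed.

Lemma affine_capH L H : affine_subspace L -> hyperplane H ->
  L `&` H !=set0 -> affine_subspace (L `&` H).
Proof.
move=> aL hH [p [Lp Hp]]; have [U ->] := affine_flat aL Lp.
by rewrite flat_capH//; exact: flatP.
Qed.

Lemma affdim_capH L H : affine_subspace L -> hyperplane H ->
  L `&` H !=set0 -> ~ L `<=` H -> affdim L = (affdim (L `&` H)).+1.
Proof.
move=> aL hH [p [Lp Hp]]; have [U ->] := affine_flat aL Lp => nLH.
rewrite flat_capH// !affdim_flat.
have [y [yU Hy]] : exists y, flat p U y /\ ~ H y.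
  apply: contrapT => h; apply: nLH => y yU.
  by apply: contrapT => Hy; apply: h; exists y.
apply: dim_capv_hker yU _; apply/eqP => h; apply: Hy; apply/(hformP _ hH).
have /(hformP _ hH) := Hp; rewrite -(subrK p y) addrC hformD h => ->.
by rewrite addr0.
Qed.

End Affine.

(** * Cells of a flat given by sign vectors *)

Section Cells.
Variables (R : realType) (d : nat).
Local Notation V := 'rV[R]_d.
Implicit Types (a x y z u v w p q : V) (c e s : R) (U W : {vspace V}).
Implicit Types (S C L H : set V) (hs T : seq (set V)) (b : bool) (t : seq bool).

Definition sg b : R := if b then 1 else - 1.

Lemma sg_neq0 b : sg b != 0.
Proof. by case: b; rewrite /sg ?oppr_eq0 oner_eq0. Qed.

Lemma sgN b : sg (~~ b) = - sg b.
Proof. by case: b; rewrite /sg //= opprK. Qed.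

Lemma sg_ge0_ex c : exists b, 0 <= sg b * c.
Proof.
have [c0|c0] := leP 0 c; first by exists true; rewrite /sg mul1r.
by exists false; rewrite /sg mulN1r oppr_ge0 ltW.
Qed.

Lemma sg_gt0_ex c : c != 0 -> exists b, 0 < sg b * c.
Proof.
move=> c0; have [b] := sg_ge0_ex c; rewrite le_eqVlt eq_sym mulf_eq0.
by rewrite (negPf (sg_neq0 b)) (negPf c0)/=; exists b.
Qed.

(** The cells of [L] cut out by the hyperplanes [hs] on the sides prescribed by
    the sign list [t]: relatively open ones, possibly empty, and the sets given
    by the weak inequalities, which are their closures in the nonempty case.
    Consing a hyperplane cuts an existing cell in two. *)
Fixpoint ocell L hs t : set V := match hs, t with
  | H :: hs', b :: t' => ocell L hs' t' `&` [set y | 0 < sg b * hform H y]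
  | _, _ => L end.

Fixpoint ccell L hs t : set V := match hs, t with
  | H :: hs', b :: t' => ccell L hs' t' `&` [set y | 0 <= sg b * hform H y]
  | _, _ => L end.

Definition meet hs : set V := [set y | forall H, H \in hs -> H y].

(** The affine hull of the face that carries [q] in its relative interior, for
    any closed cell of [L] that contains [q]. *)
Definition face_flat L hs q : set V :=
  L `&` [set y | forall H, H \in hs -> H q -> H y].

Definition hyps hs := forall H, H \in hs -> hyperplane H.

Lemma hyps_cons H hs : hyps (H :: hs) -> hyperplane H /\ hyps hs.
Proof.
by move=> h; split=> [|K Ks]; apply: h; rewrite inE ?eqxx// Ks orbT.
Qed.

Lemma ccell_sub L hs t : ccell L hs t `<=` L.
Proof. by elim: hs t => [|H hs IH] [|b t]//= y [/IH]. Qed.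

Lemma ocell_ccell L hs t : ocell L hs t `<=` ccell L hs t.
Proof. by elim: hs t => [|H hs IH] [|b t]//= y [/IH ? /ltW]. Qed.

Lemma ccellI L H hs t : ccell (L `&` H) hs t = ccell L hs t `&` H.
Proof. by elim: hs t => [|K hs IH] [|b t]//=; rewrite IH setIAC. Qed.

Lemma ocellI L H hs t : ocell (L `&` H) hs t = ocell L hs t `&` H.
Proof. by elim: hs t => [|K hs IH] [|b t]//=; rewrite IH setIAC. Qed.

Definition convex C := forall x y e, C x -> C y -> 0 <= e <= 1 ->
  C (x + e *: (y - x)).

Lemma ccell_convex L hs t : affine_subspace L -> convex (ccell L hs t).
Proof.
move=> aL; elim: hs t => [|H hs IH] [|b t]//= x y e;
  do ?[by move=> *; exact: affine_line].
move=> [Cx Hx] [Cy Hy] e01; split; first exact: IH.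
rewrite /= in Hx Hy *; rewrite hform_line; nra.
Qed.

Lemma ocell_join L hs t x y e : affine_subspace L -> ocell L hs t x ->
  ccell L hs t y -> 0 <= e < 1 -> ocell L hs t (x + e *: (y - x)).
Proof.
move=> aL; elim: hs t => [|H hs IH] [|b t]//=;
  do ?[by move=> *; exact: affine_line].
move=> [Cx Hx] [Cy Hy] e01; split; first exact: IH.
rewrite /= in Hx Hy *; rewrite hform_line; nra.
Qed.

(** An affine function of one real variable that is positive at 0 remains so on
    a small interval; [c] and [s] are its values at 0 and at 1. *)
Lemma pos_near c s : 0 < c ->
  exists2 e, 0 < e & forall e', 0 <= e' <= e -> 0 < (1 - e') * c + e' * s.
Proof.
move=> c0; have s0 := normr_ge0 s; have := ler_norm (- s); rewrite normrN => sn.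
have k0 : 0 < c + `|s| by lra.
exists (c / (2 * (c + `|s|))); first by rewrite divr_gt0// mulr_gt0.
move=> e' /andP[e0 ee].
have : e' * (2 * (c + `|s|)) <= c by rewrite -ler_pdivlMr// mulr_gt0.
nra.
Qed.

(** [q] is in the relative interior of its face: the constraints that are strict
    at [q] survive a small move, the others are constant along the face. *)
Lemma ccell_near L hs t q y : hyps hs -> affine_subspace L -> ccell L hs t q ->
  face_flat L hs q y ->
  exists2 e, 0 < e & forall e', 0 <= e' <= e -> ccell L hs t (q + e' *: (y - q)).
Proof.
move=> hH aL; elim: hs hH t => [|H hs IH] hH [|b t]/=;
  do ?[by move=> Lq [Ly _]; exists 1 => // *; exact: affine_line].
have [hyH hyhs] := hyps_cons hH.
move=> [Cq Hq] [Ly yf].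
have [|e e0 He] := IH hyhs _ Cq.
  by split=> // K Ks; apply: yf; rewrite inE Ks orbT.
have [f0|f0] := eqVneq (hform H q) 0.
  exists e => // e' ee; split; first exact: He.
  rewrite /= hform_line f0 (hformP _ hyH).1 ?mulr0 ?addr0 ?mulr0//.
  by apply: yf; rewrite ?mem_head//; exact/hformP.
have f1 : 0 < sg b * hform H q.
  by rewrite lt_def mulf_neq0 ?sg_neq0.
have [e2 e20 He2] := pos_near (sg b * hform H y) f1.
exists (Num.min e e2); first by rewrite lt_min e0.
move=> e' /andP[e'0]; rewrite le_min => /andP[l1 l2]; split.
  by apply: He; rewrite e'0.
rewrite /= hform_line; have := He2 e'; rewrite e'0 l2 => /(_ isT); nra.
Qed.

Lemma ocell_near L hs t q y : affine_subspace L -> ocell L hs t q -> L y ->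
  exists2 e, 0 < e & forall e', 0 <= e' <= e -> ocell L hs t (q + e' *: (y - q)).
Proof.
move=> aL + Ly; elim: hs t => [|H hs IH] [|b t]/=;
  do ?[by move=> Lq; exists 1 => // *; exact: affine_line].
move=> [Cq Hq]; have [e e0 He] := IH _ Cq.
have [e2 e20 He2] := pos_near (sg b * hform H y) Hq.
exists (Num.min e e2); first by rewrite lt_min e0.
move=> e' /andP[e'0]; rewrite le_min => /andP[l1 l2]; split.
  by apply: He; rewrite e'0.
rewrite /= hform_line; have := He2 e'; rewrite e'0 l2 => /(_ isT); nra.
Qed.

(** * Nearest points of cells *)

Lemma nearest_sub C S x q : nearest C x q -> S `<=` C -> S q -> nearest S x q.
Proof. by move=> [_ h] sSC Sq; split=> // y /sSC/h. Qed.

(** Small moves from [q] inside its face stay in the cell, so the inequality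
    defining the nearest point extends from the face to its affine hull. *)
Lemma nearest_face L hs t x q : hyps hs -> affine_subspace L ->
  nearest (ccell L hs t) x q -> nearest (face_flat L hs q) x q.
Proof.
move=> hH aL [Cq h]; split; first by split=> //; exact: ccell_sub Cq.
move=> y yf; have [e e0 He] := ccell_near hH aL Cq yf.
have := h (q + e *: (y - q)); rewrite addrAC subrr add0r dotvZr => hy.
by rewrite -(pmulr_rle0 _ e0); apply: hy; apply: He; rewrite lexx ltW.
Qed.

(** The point at which a segment meets [H], with the barycentric parameter [e]
    determined by the values of the form at the two ends. *)
Lemma crossing_point C H x y s : convex C -> hyperplane H -> C x -> C y ->
  0 < s * hform H x -> s * hform H y <= 0 ->
  exists e, [/\ 0 < e, e <= 1, C (x + e *: (y - x)), H (x + e *: (y - x))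
    & e * (s * hform H x - s * hform H y) = s * hform H x].
Proof.
move=> cC hH Cx Cy hx hy; set A := s * hform H x; set B := s * hform H y.
have AB : 0 < A - B by rewrite /A /B; lra.
have e0 : 0 < A / (A - B) by rewrite divr_gt0.
have e1 : A / (A - B) <= 1 by rewrite ler_pdivrMr// mul1r /A /B; lra.
have eAB : A / (A - B) * (A - B) = A by rewrite mulfVK// gt_eqF.
exists (A / (A - B)); split=> //.
  by apply: cC => //; rewrite ltW.
apply/(hformP _ hH); rewrite hform_line.
have s0 : s != 0 by apply: contraTneq hx => ->; rewrite mul0r ltxx.
apply: (mulfI s0); move: eAB; set e := A / _; rewrite /A /B; lra.
Qed.

(** When the point [q] of [C] nearest to [x] lies on one side of [H], the point
    of the opposite half of [C] nearest to [x] lies on [H]: the segment from [q]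
    to a point [y] of the opposite half crosses [H] at a point of [C], and
    distances to [x] do not decrease along this segment. *)
Lemma nearest_cross C H x q r s : s != 0 -> convex C -> hyperplane H ->
  nearest C x q -> 0 <= s * hform H q -> nearest (C `&` H) x r ->
  nearest (C `&` [set y | 0 <= - s * hform H y]) x r.
Proof.
move=> s0 cC hH Cq hq Cr.
have [ [Cr1 Hr] rmin] := Cr.
split=> [|y [Cy /=]].
  by split=> //=; rewrite (hformP _ hH).1// mulr0.
rewrite mulNr oppr_ge0 => hy.
have [q0|q0] := eqVneq (s * hform H q) 0.
  have Hq : H q by apply/(hformP _ hH)/eqP; move/eqP: q0; rewrite mulf_eq0 (negPf s0).
  have Cq' : nearest (C `&` H) x q.
    by apply: (nearest_sub Cq); [exact: subIsetl|split => //; case: Cq].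
  by rewrite (nearest_uniq Cr Cq'); case: Cq => _; apply.
have hq' : 0 < s * hform H q by rewrite lt_def q0.
have [Cq1 qmin] := Cq.
have [e [e0 e1 Cm Hm em]] := crossing_point cC hH Cq1 Cy hq' hy.
have m1 := rmin _ (conj Cm Hm).
have m2 := qmin _ Cr1.
have := dotv_ge0 (q - r).
(* The defining inequality at the crossing point is a convex combination of the
   desired one at [y] and of one at [q], and the latter has a known sign. *)
have : dotv (x - r) (q + e *: (y - q) - r)
  = e * dotv (x - r) (y - r) + (1 - e) * dotv (x - r) (q - r).
  by rewrite !dotvE; ring.
have : dotv (x - r) (q - r) = - dotv (x - q) (r - q) + dotv (q - r) (q - r).
  by rewrite !dotvE !(dotvC q) !(dotvC r); ring.
move: m1 m2 e0 e1; clear.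
set X := dotv (x - r) (q - r); set Y := dotv (x - r) (y - r).
set Z := dotv (x - q) _; set W := dotv (q - r) _; set Q := dotv _ (_ + _ - _).
move=> ? ? e0 ? hX hQ ?; rewrite -(pmulr_rle0 _ e0); nra.
Qed.

(** Existence by deletion and restriction: the nearest point of a half cell is
    either that of the whole cell or that of the wall. *)
Lemma nearest_exists L hs t x : hyps hs -> affine_subspace L ->
  ccell L hs t !=set0 -> exists q, nearest (ccell L hs t) x q.
Proof.
elim: hs t L => [|H hs IH] [|b t] L hH aL /=;
  do ?[by move: aL => [p [U ->]] _; eexists; exact: nearest_oproj].
have [hyH hyhs] := hyps_cons hH.
move=> [z [Cz hz]]; rewrite /= in hz.
have [|q Cq] := IH t L hyhs aL; first by exists z.
have [hq|hq] := leP 0 (sg b * hform H q).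
  by exists q; apply: (nearest_sub Cq); [exact: subIsetl|split => //; case: Cq].
have cC := @ccell_convex L hs t aL.
have hq' : 0 < - sg b * hform H q by rewrite mulNr oppr_gt0.
have [Cq1 _] := Cq.
have [|e [_ _ Cm Hm _]] := crossing_point cC hyH Cq1 Cz hq'.
  by rewrite mulNr oppr_le0.
have ne : L `&` H !=set0.
  by exists (q + e *: (z - q)); split=> //; exact: ccell_sub Cm.
have [|r] := IH t (L `&` H) hyhs (affine_capH aL hyH ne).
  by exists (q + e *: (z - q)); rewrite ccellI.
rewrite ccellI => Cr; exists r.
have sb0 : - sg b != 0 by rewrite oppr_eq0 sg_neq0.
have := nearest_cross sb0 cC hyH Cq (ltW hq') Cr.
by rewrite opprK.
Qed.

(** * General position *)

(** General position of [x] with respect to the flats [L] meet [T]: orthogonal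
    projections to such a flat avoid the hyperplanes that do not contain it.  This
    is stable under deletion and under restriction to a hyperplane. *)
Definition genpos hs L x := forall T, {subset T <= hs} ->
  forall q, nearest (L `&` meet T) x q ->
  forall H, H \in hs -> H q -> L `&` meet T `<=` H.

Lemma genpos_sub hs hs' L x : {subset hs' <= hs} -> genpos hs L x ->
  genpos hs' L x.
Proof.
by move=> sub g T Ths q qT H Hs Hq; apply: g qT _ _ Hq;
  [move=> K /Ths/sub|exact: sub].
Qed.

Lemma genpos_capH H hs L x : genpos (H :: hs) L x -> genpos hs (L `&` H) x.
Proof.
move=> g T Ths q.
have -> : L `&` H `&` meet T = L `&` meet (H :: T).
  apply/seteqP; split=> y.
    by move=> [[Ly Hy] yT]; split=> // K; rewrite inE => /orP[/eqP ->//|/yT].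
  move=> [Ly yT]; split; first by split=> //; apply: yT; rewrite mem_head.
  by move=> K Ks; apply: yT; rewrite inE Ks orbT.
move=> qT K Ks Kq; apply: g qT _ _ Kq; last by rewrite inE Ks orbT.
by move=> J; rewrite !inE => /orP[->//|/Ths ->]; rewrite orbT.
Qed.

Lemma face_flatE L hs q :
  face_flat L hs q = L `&` meet [seq H <- hs | `[< H q >]].
Proof.
apply/seteqP; split=> y [Ly yh]; split=> // H.
  by rewrite mem_filter => /andP[/asboolP Hq Hs]; exact: yh.
by move=> Hs Hq; apply: yh; rewrite mem_filter Hs andbT; exact/asboolP.
Qed.

(** The point nearest to [x] in a cell is the orthogonal projection of [x] to the
    affine hull of a face, to which general position applies. *)
Lemma genpos_face hs hs' L t x q : hyps hs -> affine_subspace L ->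
  {subset hs <= hs'} -> genpos hs' L x -> nearest (ccell L hs t) x q ->
  forall H, H \in hs' -> H q -> face_flat L hs q `<=` H.
Proof.
move=> hH aL sub g Cq H Hs Hq; have := nearest_face hH aL Cq.
rewrite face_flatE => nq; apply: g nq _ Hs Hq => K.
by rewrite mem_filter => /andP[_ /sub].
Qed.

(** * Counting *)

(** The open cell of sign [t] is nonempty and the point of the closed cell nearest
    to [x] lies in the relative interior of a face of dimension [k]. *)
Definition hit hs L k x t : bool := `[< ocell L hs t !=set0 /\
  exists2 q, nearest (ccell L hs t) x q & affdim (face_flat L hs q) = k >].

Lemma hitE hs L k x t q : ocell L hs t !=set0 -> nearest (ccell L hs t) x q ->
  hit hs L k x t = (affdim (face_flat L hs q) == k).
Proof.
move=> o nq; apply/asboolP/eqP => [[_ [q' nq' <-]]|<-]; last first.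
  by split=> //; exists q.
by rewrite (nearest_uniq nq nq').
Qed.

Lemma hit0 hs L k x t : ~ (ocell L hs t !=set0) -> hit hs L k x t = false.
Proof. by move=> o; apply/asboolP => -[]. Qed.

(** On the side of [H] that contains the nearest point [q] of the uncut cell, [q]
    is still nearest; if [q] happens to lie on [H], so does the whole face of
    [q], by general position, and its affine hull is not affected by [H]. *)
Lemma hit_same_side H hs L k x b t q : hyps (H :: hs) -> affine_subspace L ->
  genpos (H :: hs) L x -> nearest (ccell L hs t) x q ->
  0 <= sg b * hform H q -> ocell L (H :: hs) (b :: t) !=set0 ->
  hit (H :: hs) L k x (b :: t) = hit hs L k x t.
Proof.
move=> hH aL g nq hq o; have [hyH hyhs] := hyps_cons hH.
have nq' : nearest (ccell L (H :: hs) (b :: t)) x q.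
  by apply: (nearest_sub nq); [exact: subIsetl|split => //; case: nq].
rewrite (hitE k o nq') (@hitE _ _ k _ _ q)//; last by case: o => z [oz _]; exists z.
congr (affdim _ == _); apply/seteqP; split=> y [Ly yh]; split=> // K.
  by move=> Ks; apply: yh; rewrite inE Ks orbT.
rewrite inE => /orP[/eqP ->|]; last exact: yh.
move=> Hq; apply: (genpos_face hyhs aL _ g nq _ Hq); rewrite ?mem_head//.
by move=> J Js; rewrite inE Js orbT.
Qed.

Lemma hit_other_side H hs L k x b t q : hyps (H :: hs) -> affine_subspace L ->
  nearest (ccell L hs t) x q ->
  0 <= sg b * hform H q -> ocell L (H :: hs) (~~ b :: t) !=set0 ->
  ocell (L `&` H) hs t !=set0 ->
  hit (H :: hs) L k x (~~ b :: t) = hit hs (L `&` H) k x t.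
Proof.
move=> hH aL nq hq o oH; have [hyH hyhs] := hyps_cons hH.
have aLH : affine_subspace (L `&` H).
  apply: affine_capH => //; move: oH; rewrite ocellI.
  move=> -[z [/ocell_ccell/ccell_sub Lz Hz]].
  by exists z.
have [r nr] : exists r, nearest (ccell (L `&` H) hs t) x r.
  by apply: nearest_exists => //; case: oH => z /ocell_ccell; exists z.
rewrite (hitE k oH nr).
rewrite (@hitE _ _ k x _ r)//.
  have Hr : H r by case: nr => /ccell_sub[].
  congr (affdim _ == _); apply/seteqP; split=> y.
    move=> [Ly yh]; split; first by split=> //; apply: yh; rewrite ?mem_head.
    by move=> K Ks; apply: yh; rewrite inE Ks orbT.
  move=> [[Ly Hy] yh]; split=> // K.
  by rewrite inE => /orP[/eqP ->//|]; exact: yh.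
rewrite ccellI in nr.
rewrite /= sgN; exact: nearest_cross (sg_neq0 b) (@ccell_convex L hs t aL) hyH nq hq nr.
Qed.

(** The termwise form of the deletion-restriction recursion.  If the open cell
    meets [H], then both halves and the wall are nonempty and the two preceding
    lemmas apply, with [b] the side of the nearest point.  Otherwise the cell
    lies strictly on the side [b] of [H], and the other half and the wall are
    empty. *)
Lemma hit_split H hs L k x t : hyps (H :: hs) -> affine_subspace L ->
  genpos (H :: hs) L x -> ~ L `<=` H ->
  (hit (H :: hs) L k x (true :: t) + hit (H :: hs) L k x (false :: t) =
   hit hs L k x t + hit hs (L `&` H) k x t)%N.
Proof.
move=> hH aL g nLH; have [hyH hyhs] := hyps_cons hH.
suff [b [h1 h2]] : exists b,
    hit (H :: hs) L k x (b :: t) = hit hs L k x t /\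
    hit (H :: hs) L k x (~~ b :: t) = hit hs (L `&` H) k x t.
  by case: b h1 h2 => -> ->; rewrite // addnC.
have empty S C : S `<=` C -> ~ (C !=set0) -> ~ (S !=set0).
  by move=> sSC nC [y /sSC Cy]; apply: nC; exists y.
have [[p0 Op0]|nO] := pselect (ocell L hs t !=set0); last first.
  exists true; rewrite !(hit0 _ _ nO) !hit0 ?ocellI//;
    by apply: empty nO; exact: subIsetl.
have [|q nq] := nearest_exists x hyhs aL (t := t).
  by exists p0; exact: ocell_ccell.
have [ [p1 [Op1 Hp1]]|nH] := pselect (ocell L hs t `&` H !=set0).
  have [z Lz fz] : exists2 z, L z & hform H z != 0.
    apply: contrapT => nz; apply: nLH => y Ly; apply/(hformP _ hyH)/eqP.
    by apply: contrapT => /negP ?; apply: nz; exists y.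
  have Lp1 : L p1 by exact: ccell_sub (ocell_ccell Op1).
  have f0 : hform H p1 = 0 by exact/hformP.
  (* [L] leaves [H] at [p1] towards [z], hence also in the opposite direction. *)
  have side b : ocell L (H :: hs) (b :: t) !=set0.
    have [w Lw fw] : exists2 w, L w & 0 < sg b * hform H w.
      have [b' fb'] := sg_gt0_ex fz.
      have [<-|/negPf bb'] := eqVneq b' b; first by exists z.
      exists (p1 + (- 1) *: (z - p1)); first exact: affine_line.
      rewrite hform_line f0 mulr0 add0r mulN1r mulrN -mulNr -sgN.
      by case: (b) (b') bb' fb' => [] [].
    have [e e0 He] := ocell_near aL Op1 Lw.
    exists (p1 + e *: (w - p1)); split; first by apply: He; rewrite lexx ltW.
    by rewrite /= hform_line f0 mulr0 add0r mulrCA mulr_gt0.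
  have [b hb] := sg_ge0_ex (hform H q).
  exists b; split; first exact: (hit_same_side k hH aL g nq hb).
  by apply: (hit_other_side k hH aL nq hb) => //; rewrite ocellI; exists p1.
have fo : hform H p0 != 0.
  by apply/eqP => /(hformP _ hyH) Ho; apply: nH; exists p0.
have [b fb] := sg_gt0_ex fo.
have pos y : ccell L hs t y -> 0 <= sg b * hform H y.
  move=> Cy; rewrite leNgt; apply/negP => fy; apply: nH.
  have [|e [e0 e1 _ He eE]] := crossing_point (@ccell_convex L hs t aL) hyH
    (ocell_ccell Op0) Cy fb; first exact: ltW.
  exists (p0 + e *: (y - p0)); split=> //; apply: ocell_join => //.
  rewrite ltW//= lt_neqAle e1 andbT; apply/eqP => e1'.
  by move: eE fy; rewrite e1'; lra.
exists b; split.
  apply: (hit_same_side k hH aL g nq); first by apply: pos; case: nq.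
  by exists p0.
rewrite !hit0 ?ocellI// => -[y [Oy]].
by rewrite /= sgN mulNr oppr_gt0 ltNge pos//; exact: ocell_ccell.
Qed.

Fixpoint signs n : seq (seq bool) :=
  if n is n'.+1 then map (cons true) (signs n') ++ map (cons false) (signs n')
  else [:: [::]].

Lemma mem_signs n t : (t \in signs n) = (size t == n).
Proof.
elim: n t => [|n IH] [|b t] /=; rewrite ?inE//.
  by rewrite mem_cat; apply/negP => /orP[] /mapP[].
have memc b' : ((b :: t) \in map (cons b') (signs n)) = (b == b') && (size t == n).
  apply/mapP/andP => [[t' t's [-> ->]]|[/eqP -> ts]]; first by rewrite eqxx -IH.
  by exists t => //; rewrite IH.
by rewrite mem_cat !memc eqSS; case: b {memc} => //=; rewrite orbF.
Qed.

Lemma signs_uniq n : uniq (signs n).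
Proof.
elim: n => //= n IH; rewrite cat_uniq !map_inj_uniq ?IH ?andbT/=;
  try by move=> ? ? [].
by apply/hasPn => _ /mapP[t _ ->]; apply/mapP => -[].
Qed.

Definition hits hs L k x : nat := \sum_(t <- signs (size hs)) hit hs L k x t.

Lemma hits_split H hs L k x : hyps (H :: hs) -> affine_subspace L ->
  genpos (H :: hs) L x -> ~ L `<=` H ->
  hits (H :: hs) L k x = (hits hs L k x + hits hs (L `&` H) k x)%N.
Proof.
move=> hH aL g nLH; rewrite /hits/= big_cat !big_map/= -[LHS]big_split -[RHS]big_split/=.
by apply: eq_bigr => t _; exact: hit_split.
Qed.

Lemma hits_set0 hs k x : hits hs set0 k x = 0%N.
Proof.
by rewrite /hits big1// => t _; rewrite hit0// => -[y /ocell_ccell/ccell_sub].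
Qed.

Lemma hits_sub H hs L k x : hyperplane H -> L `<=` H ->
  hits (H :: hs) L k x = 0%N.
Proof.
move=> hH LH; rewrite /hits/= big_cat !big_map/= -[LHS]big_split/=.
rewrite big1// => t _; rewrite !hit0//; move=> -[y []].
  by move=> /ocell_ccell/ccell_sub/LH/(hformP _ hH) /= ->; rewrite mulr0 ltxx.
by move=> /ocell_ccell/ccell_sub/LH/(hformP _ hH) /= ->; rewrite mulr0 ltxx.
Qed.

(** * The deletion-restriction recursion *)

(** The characteristic polynomial of the trace on [L] of a list of hyperplanes,
    by deletion and restriction.  Members that coincide on [L], miss [L] or
    contain [L] are admitted; in the last case the value is zero. *)
Fixpoint lchi hs L : {poly int} :=
  if hs is H :: hs' then lchi hs' L - lchi hs' (L `&` H)
  else if L == set0 then 0 else 'X^(affdim L).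

Lemma lchi_set0 hs : lchi hs set0 = 0.
Proof. by elim: hs => [|H hs IH] /=; rewrite ?eqxx// set0I IH subrr. Qed.

(** Both sides satisfy the same recursion.  Restriction to a hyperplane that is
    transverse to [L] lowers the dimension by one, which accounts for the minus
    sign in the definition of [lchi]; when the hyperplane contains [L], there
    are no open cells. *)
Lemma lchi_hits hs L k x : hyps hs -> affine_subspace L -> genpos hs L x ->
  (lchi hs L)`_k = (-1) ^+ (affdim L + k) * (hits hs L k x)%:R.
Proof.
elim: hs L => [|H hs IH] L hH aL g.
  have [p [U LU]] := aL.
  have Lp : L p by rewrite LU; exact: flat_self.
  have nq : nearest (ccell L [::] [::]) x (p + oproj U (x - p)).
    by rewrite /= LU; exact: nearest_oproj.
  rewrite /hits/= big_seq1 (@hitE _ _ k _ _ _ _ nq); last by exists p.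
  have -> : face_flat L [::] (p + oproj U (x - p)) = L.
    by apply/seteqP; split=> [y []|y Ly].
  case: eqP => [L0|_]; first by rewrite L0 in Lp.
  rewrite coefXn eq_sym; case: eqP => [<-|_]; last by rewrite mulr0.
  by rewrite addnn -mul2n exprM sqrrN expr1n mul1r.
have [hyH hyhs] := hyps_cons hH.
have ghs : genpos hs L x.
  by apply: genpos_sub g => K Ks; rewrite inE Ks orbT.
rewrite /= coefB IH//.
have [LH|nLH] := pselect (L `<=` H).
  rewrite hits_sub// mulr0 (_ : L `&` H = L) ?IH ?subrr//.
  by apply/seteqP; split=> [y []|y Ly] //; split=> //; exact: LH.
rewrite (hits_split k hH aL g nLH) natrD mulrDr; congr (_ + _).
have [LH0|/set0P LH0] := eqVneq (L `&` H) set0.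
  by rewrite LH0 lchi_set0 hits_set0 coef0 mulr0 oppr0.
rewrite (affdim_capH aL hyH LH0 nLH) IH//.
- by rewrite addSn exprS mulN1r mulNr.
- exact: affine_capH.
- exact: genpos_capH.
Qed.

End Cells.

(** * The characteristic polynomial of a restriction *)

Section Charpoly.
Variables (R : realType) (d : nat).
Local Notation V := 'rV[R]_d.
Implicit Types (x y q : V) (S L H G : set V) (hs T : seq (set V)).
Implicit Types (A B : {fset set V}).

Lemma big_fpowersetU1 (K : choiceType) (M : nmodType) (x : K) (A : {fset K})
  (G : {fset K} -> M) : x \notin A ->
  \sum_(B <- fpowerset (x |` A)%fset) G B =
  \sum_(B <- fpowerset A) G B + \sum_(B <- fpowerset A) G (x |` B)%fset.
Proof.
move=> xA; rewrite -(big_map (fsetU [fset x]) predT G) -big_cat; apply: perm_big.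
have xB (B : {fset K}) : B \in fpowerset A -> x \notin B.
  by rewrite fpowersetE => /fsubsetP BA; apply: contra xA => /BA.
apply: uniq_perm => [||B]; first exact: fset_uniq.
  rewrite cat_uniq !map_inj_in_uniq ?fset_uniq ?andbT//=; last first.
    move=> B C /xB xB' /xB xC' e.
    by rewrite -(fsetU1K xB') e fsetU1K.
  apply/hasPn => _ /mapP[B _ ->]; apply/negP => /xB.
  by rewrite fset1U1.
rewrite mem_cat fpowersetE; apply/idP/orP => [BA|[|/mapP[C + ->]]].
- have [xB'|xB'] := boolP (x \in B); [right|left].
    apply/mapP; exists (B `\ x)%fset; last by rewrite fsetD1K.
    by rewrite fpowersetE fsubDset.
  rewrite fpowersetE; apply/fsubsetP => y yB.
  have := fsubsetP BA _ yB; rewrite in_fset1U => /orP[/eqP yx|//].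
  by rewrite -yx yB in xB'.
- by rewrite fpowersetE => /fsubset_trans; apply; exact: fsubsetU1.
- by rewrite fpowersetE => CA; exact: fsetUS.
Qed.

Lemma inter_inU1 L H B : inter_in L (H |` B)%fset = inter_in (L `&` H) B.
Proof.
apply/seteqP; split=> y.
  move=> [Ly By]; split; first by split=> //; apply: By => /=; rewrite fset1U1.
  by move=> G /= GB; apply: By => /=; rewrite in_fsetU GB orbT.
move=> [[Ly Hy] By]; split=> // G /=; rewrite in_fset1U => /orP[/eqP ->//|].
exact: By.
Qed.

(** Splitting the subfamilies according to whether they contain the head gives
    deletion (those that do not) and restriction (those that do, with one more
    sign). *)
Lemma charpoly_lchi L hs : uniq hs ->
  charpoly L [fset H in hs] = lchi hs L.
Proof.
elim: hs L => [|H hs IH] L.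
  have -> : [fset H in [::]] = fset0 :> {fset set V}.
    by apply/fsetP => z; rewrite inE.
  rewrite /charpoly fpowerset0 big_mkcond big_seq_fset1 /inter_in/=.
  have -> : [set` fset0] = set0 :> set (set V) by apply/seteqP; split.
  by move=> _; rewrite bigcap_set0 setIT expr0 scale1r if_neg.
move=> /= /andP[Hhs uhs].
have -> : [fset G in H :: hs] = (H |` [fset G in hs])%fset.
  by apply/fsetP => z; rewrite !inE.
rewrite /charpoly big_mkcond big_fpowersetU1 ?inE//= -!IH//.
rewrite /charpoly !(big_mkcond (fun B => inter_in _ B != set0)) /=; congr (_ + _).
rewrite -sumrN big_seq [RHS]big_seq; apply: eq_bigr => B.
rewrite fpowersetE => /fsubsetP Bhs; rewrite inter_inU1; case: ifP => _; last first.
  by rewrite oppr0.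
rewrite cardfsU1 (_ : H \notin B); last first.
  by apply/negP => /Bhs; rewrite inE (negPf Hhs).
by rewrite exprS mulN1r scaleNr.
Qed.

Lemma lchi_capL L S hs : S `<=` L ->
  lchi [seq H `&` L | H <- hs] S = lchi hs S.
Proof.
elim: hs S => [//|H hs IH] S SL /=; rewrite IH// setICA.
by rewrite [S `&` L]setIidl// setIC IH// => y [/SL].
Qed.

Lemma lchi_filter0 L hs : lchi [seq H <- hs | H != set0] L = lchi hs L.
Proof.
elim: hs L => [//|H hs IH] L /=; case: eqP => [->|_] /=; rewrite !IH//.
by rewrite setI0 lchi_set0 subr0.
Qed.

(** Deletion and restriction to [H] have the same value when [H] contains [L];
    this makes repetitions in the list harmless. *)
Lemma lchi_mem0 L H hs : H \in hs -> L `<=` H -> lchi hs L = 0.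
Proof.
elim: hs L => [//|G hs IH] L /=; rewrite inE => /orP[/eqP <- LH|Hs LH].
  by rewrite setIidl// subrr.
by rewrite !IH// ?subrr// => y [/LH].
Qed.

Lemma lchi_undup L hs : lchi (undup hs) L = lchi hs L.
Proof.
elim: hs L => [//|H hs IH] L /=; case: ifP => Hs /=; rewrite !IH//.
by rewrite (@lchi_mem0 (L `&` H) H)// ?subr0//; exact: subIsetr.
Qed.

(** The hyperplanes whose traces on [L] form, up to empty traces and repetitions,
    the restriction of the arrangement to [L]. *)
Definition crossing A L : seq (set V) :=
  [seq H <- enum_fset A | ~~ `[< L `<=` H >]].

Lemma charpoly_restriction A L :
  charpoly L (restriction A L) = lchi (crossing A L) L.
Proof.
rewrite -(lchi_capL _ (@subset_refl _ L)) -lchi_filter0 -lchi_undup.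
rewrite -charpoly_lchi ?undup_uniq//; congr (charpoly _ _).
apply/fsetP => G; rewrite !inE mem_undup mem_filter andbA andbC; congr (_ && _).
apply/andP/mapP => [ [/imfsetP[H /= HA GE] GL]|[H]].
  exists H => //; rewrite mem_filter; apply/andP; split=> //.
  apply: contra GL => /asboolP LH; rewrite GE; apply/eqP; exact: setIidr.
rewrite mem_filter => /andP[/asboolP LH HA] ->; split.
  by apply/imfsetP; exists H.
by apply: contra_not_neq LH => <-; exact: subIsetl.
Qed.

(** * Flats of an arrangement *)

Lemma affine_setT : affine_subspace [set: V].
Proof. by exists 0, fullv; apply/seteqP; split=> // y _ /=; rewrite memvf. Qed.

Lemma affine_capmeet L hs : hyps hs -> affine_subspace L ->
  L `&` meet hs !=set0 -> affine_subspace (L `&` meet hs).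
Proof.
elim: hs L => [|H hs IH] L hH aL.
  by rewrite (_ : meet [::] = setT) ?setIT//; apply/seteqP; split.
have [hyH hyhs] := hyps_cons hH.
have -> : L `&` meet (H :: hs) = L `&` H `&` meet hs.
  apply/seteqP; split=> y.
    move=> [Ly yT]; split; first by split=> //; apply: yT; rewrite mem_head.
    by move=> K Ks; apply: yT; rewrite inE Ks orbT.
  by move=> [[Ly Hy] yT]; split=> // K; rewrite inE => /orP[/eqP ->//|/yT].
move=> ne; apply: IH => //; apply: affine_capH => //.
by case: ne => y [? _]; exists y.
Qed.

Lemma flats_prop A L : is_arrangement A -> L \in flats A ->
  [/\ affine_subspace L, L !=set0 &
    forall y, (forall H, H \in A -> L `<=` H -> H y) -> L y].
Proof.
move=> hA; rewrite !inE => /andP[/imfsetP[B /= BA LE] /set0P L0].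
rewrite fpowersetE in BA; have BA' := fsubsetP BA.
have LE' : L = setT `&` meet (enum_fset B).
  by rewrite LE /inter_in; congr (_ `&` _); apply/seteqP; split=> y h H /h.
split=> //; first rewrite LE'; first apply: affine_capmeet.
- by move=> H /BA'/hA.
- exact: affine_setT.
- by rewrite -LE'.
- move=> y h; rewrite LE'; split=> // H HB; apply: (h _ (BA' _ HB)).
  by rewrite LE' => z [_]; apply.
Qed.

Lemma crossing_sub A L : {subset crossing A L <= enum_fset A}.
Proof. by move=> H; rewrite mem_filter => /andP[]. Qed.

Lemma hyps_crossing A L : is_arrangement A -> hyps (crossing A L).
Proof. by move=> hA H /crossing_sub/hA. Qed.

(** A flat is cut out by the hyperplanes that contain it, so every flat of the
    arrangement inside [L] is also a flat inside the whole space. *)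
Lemma genpos_flat A L x : genpos (enum_fset A) setT x -> is_arrangement A ->
  L \in flats A -> genpos (crossing A L) L x.
Proof.
move=> g hA LA T Ts q nq H Hs Hq; have [_ _ Lh] := flats_prop hA LA.
pose T' := T ++ [seq H <- enum_fset A | `[< L `<=` H >]].
have TE : L `&` meet T = setT `&` meet T'.
  apply/seteqP; split=> y.
    move=> [Ly yT]; split=> // K; rewrite mem_cat mem_filter.
    by move=> /orP[/yT//|/andP[/asboolP + _]]; apply.
  move=> [_ yT]; split=> [|K KT]; last by apply: yT; rewrite mem_cat KT.
  apply: Lh => K KA LK; apply: yT; rewrite mem_cat mem_filter.
  by rewrite (asboolT LK) KA orbT.
rewrite TE in nq *; apply: g nq _ (crossing_sub Hs) Hq => K.
by rewrite mem_cat => /orP[/Ts/crossing_sub//|]; rewrite mem_filter => /andP[].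
Qed.

Lemma level_charpoly_hits A (a : nat -> nat -> int) x j k :
  is_arrangement A -> genpos (enum_fset A) setT x -> (k <= j)%N ->
  level_charpoly A j = \sum_(k < j.+1) ((-1) ^+ (j - k) * a k j) *: 'X^k ->
  a k j = \sum_(L <- flats_dim A j) (hits (crossing A L) L k x)%:R.
Proof.
move=> hA g kj /(congr1 (fun p : {poly int} => p`_k)).
rewrite -(poly_def _ (fun k => (-1) ^+ (j - k) * a k j)) coef_poly ltnS kj.
rewrite /level_charpoly coef_sum.
under eq_big_seq => L.
  rewrite inE => /andP[LA /eqP Lj].
  have [aL _ _] := flats_prop hA LA.
  rewrite charpoly_restriction (@lchi_hits _ _ _ _ _ x); last 3 first.
  - exact: hyps_crossing.
  - exact: aL.
  - exact: genpos_flat.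
  rewrite Lj; over.
have sE : (-1) ^+ (j + k) = (-1) ^+ (j - k) :> int.
  by rewrite -{1}(subnK kj) -addnA addnn exprD -mul2n exprM sqrrN !expr1n mulr1.
rewrite -mulr_sumr sE => /mulfI -> //.
by rewrite signr_eq0.
Qed.

End Charpoly.

(** * The closed cell around a point and its faces *)

Section PointCells.
Variables (R : realType) (d : nat).
Local Notation V := 'rV[R]_d.
Implicit Types (a x y z u v p q r : V) (c e s : R) (U W : {vspace V}).
Implicit Types (S C L H P F : set V) (hs T : seq (set V)) (t : seq bool).
Implicit Types (A B : {fset set V}).

(** The smallest closed cell of the arrangement containing [q], in which [q] is a
    relative interior point.  Chambers, their faces and the faces of these are
    all of this form, so that no sign vectors are needed to describe them. *)
Definition pcell hs q : set V := [set y | forall H, H \in hs ->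
  0 <= hform H q * hform H y /\ (hform H q = 0 -> hform H y = 0)].

Definition pflat hs q : set V := face_flat setT hs q.

Lemma pcell_self hs q : pcell hs q q.
Proof. by move=> H Hs; split=> //; rewrite -expr2 sqr_ge0. Qed.

Lemma pflat_self hs q : pflat hs q q.
Proof. by split. Qed.

Lemma pflat_affine hs q : hyps hs -> affine_subspace (pflat hs q).
Proof.
move=> hH; rewrite /pflat face_flatE; apply: affine_capmeet.
- by move=> H; rewrite mem_filter => /andP[_ /hH].
- exact: affine_setT.
- by exists q; split=> // H; rewrite mem_filter => /andP[/asboolP].
Qed.

Lemma pcell_flat hs q : hyps hs -> pcell hs q `<=` pflat hs q.
Proof.
move=> hH y qy; split=> // H Hs /(hformP _ (hH _ Hs)) Hq.
by apply/(hformP _ (hH _ Hs)); have [_] := qy _ Hs; exact.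
Qed.

Lemma pcell_trans hs p q r : pcell hs p q -> pcell hs q r -> pcell hs p r.
Proof.
move=> pq qr H Hs; have [h1 h2] := pq _ Hs; have [h3 h4] := qr _ Hs.
split=> [|/h2/h4//].
have [q0|q0] := eqVneq (hform H q) 0; first by rewrite h4// mulr0.
have : 0 < hform H q ^+ 2 by rewrite lt_def sqr_ge0 expf_neq0.
rewrite expr2 => hq; rewrite -(pmulr_rge0 _ hq).
by have := mulr_ge0 h1 h3; congr (_ <= _); ring.
Qed.

(** Being in the cell of [q] amounts to being in the cell of [p] and satisfying
    the equations that hold at [q]. *)
Lemma pcell_face hs p q : hyps hs -> pcell hs p q ->
  pcell hs q = pcell hs p `&` pflat hs q.
Proof.
move=> hH pq; apply/seteqP; split=> y.
  by move=> qy; split; [exact: pcell_trans qy|exact: pcell_flat].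
move=> [py [_ yq]] H Hs; have [h1 h2] := pq _ Hs; have [h3 h4] := py _ Hs.
have q0 : hform H q = 0 -> hform H y = 0.
  by move=> /(hformP _ (hH _ Hs)) /(yq _ Hs) /(hformP _ (hH _ Hs)).
split=> //; have [/q0 ->|qn0] := eqVneq (hform H q) 0; first by rewrite mulr0.
have p0 : hform H p != 0 by apply: contra_neq qn0.
have : 0 < hform H p ^+ 2 by rewrite lt_def sqr_ge0 expf_neq0.
rewrite expr2 => hq; rewrite -(pmulr_rge0 _ hq).
by have := mulr_ge0 h1 h3; congr (_ <= _); ring.
Qed.

Lemma pcell_convex hs q : convex (pcell hs q).
Proof.
move=> x y e qx qy e01 H Hs; have [h1 h2] := qx _ Hs; have [h3 h4] := qy _ Hs.
rewrite hform_line; split; first nra.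
by move=> q0; rewrite h2// h4// !mulr0 addr0.
Qed.

Lemma pcell_near hs q y : hyps hs -> pflat hs q y ->
  exists2 e, 0 < e & forall e', 0 <= e' <= e -> pcell hs q (q + e' *: (y - q)).
Proof.
move=> hH [_ qy]; elim: hs hH qy => [|H hs IH] hH qy.
  by exists 1 => // e' _ H.
have [hyH hyhs] := hyps_cons hH.
have [//||e e0 he] := IH.
  by move=> K Ks; apply: qy; rewrite inE Ks orbT.
have [q0|q0] := eqVneq (hform H q) 0.
  exists e => // e' ee K; rewrite inE => /orP[/eqP ->|]; last exact: he.
  rewrite q0 mul0r; split=> // _; rewrite hform_line q0.
  rewrite (hformP y hyH).1 ?mulr0 ?addr0//.
  by apply: qy; rewrite ?mem_head//; exact/hformP.
have h0 : 0 < hform H q * hform H q by rewrite -expr2 lt_def sqr_ge0 expf_neq0.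
have [e2 e20 He2] := pos_near (hform H q * hform H y) h0.
exists (Num.min e e2); first by rewrite lt_min e0.
move=> e' /andP[e'0]; rewrite le_min => /andP[l1 l2] K.
rewrite inE => /orP[/eqP ->|]; last by apply: he; rewrite e'0.
split; last by move/eqP; rewrite (negPf q0).
rewrite hform_line; have := He2 e'; rewrite e'0 l2 => /(_ isT); nra.
Qed.

Lemma pcell_reflect hs q y : hyps hs -> pflat hs q y ->
  exists2 e, 0 < e & pcell hs q (q - e *: (y - q)).
Proof.
move=> hH qy; have [|e e0 He] := @pcell_near hs q (q + (- 1) *: (y - q)) hH.
  by apply: affine_line => //; [exact: pflat_affine|exact: pflat_self].
exists e => //; have := He e; rewrite lexx ltW// => /(_ isT).
by rewrite addrAC subrr add0r scaleN1r scalerN.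
Qed.

Lemma affdim_pcell hs q : hyps hs -> affdim (pcell hs q) = affdim (pflat hs q).
Proof.
move=> hH; have [U UE] := affine_flat (pflat_affine q hH) (pflat_self hs q).
rewrite UE affdim_flat; apply: affdim_core.
- exact: pcell_self.
- by rewrite -UE; exact: pcell_flat.
- move=> u uU; have [|e e0 He] := @pcell_near hs q (q + u) hH.
    by rewrite UE /flat/= addrAC subrr add0r.
  exists e => //; have := He e; rewrite lexx ltW// => /(_ isT).
  by rewrite (addrAC q) subrr add0r.
Qed.

Lemma pcell_inj_flat hs p q : hyps hs -> pcell hs p = pcell hs q ->
  pflat hs p = pflat hs q.
Proof.
move=> hH.
suff sub p' q' : pcell hs p' = pcell hs q' -> pflat hs p' `<=` pflat hs q'.
  by move=> e; apply/seteqP; split; exact: sub.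
move=> e y [_ yp]; split=> // H Hs /(hformP _ (hH _ Hs)) Hq; apply: yp => //.
have : pcell hs q' p' by rewrite -e; exact: pcell_self.
by move=> /(_ _ Hs)[_ /(_ Hq)] /(hformP _ (hH _ Hs)).
Qed.

(** The sum of the forms vanishing at [q], oriented to be nonnegative on the cell
    of [p], supports this cell exactly along the cell of [q]. *)
Lemma is_face_pcell hs p q : hyps hs -> pcell hs p q ->
  is_face (pcell hs p) (pcell hs q).
Proof.
move=> hH pq; split; first by exists q; exact: pcell_self.
pose Z := [seq H <- hs | `[< H q >]].
pose psi y := \sum_(H <- Z) hform H p * hform H y.
exists (- \sum_(H <- Z) hform H p *: hvec H), (- \sum_(H <- Z) hform H p * hoff H).
have psiE y : dotv (- \sum_(H <- Z) hform H p *: hvec H) y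
    - (- \sum_(H <- Z) hform H p * hoff H) = - psi y.
  rewrite dotvNl /psi; elim: (Z) => [|H s IH].
    by rewrite !big_nil dotv0l; lra.
  rewrite !big_cons dotvDl dotvZl; move: IH; rewrite /hform; lra.
have Zsub H : H \in Z -> H \in hs by rewrite mem_filter => /andP[].
have psi_ge0 y : pcell hs p y -> 0 <= psi y.
  by move=> py; rewrite /psi big_seq sumr_ge0// => H /Zsub/py[].
split=> [y /psi_ge0|]; first by have := psiE y; lra.
have -> : [set x | dotv (- \sum_(H <- Z) hform H p *: hvec H) x =
    - \sum_(H <- Z) hform H p * hoff H] = [set x | psi x = 0].
  by apply/seteqP; split=> y /= ; have := psiE y; lra.
rewrite (pcell_face hH pq); apply/seteqP; split=> y [py].
  move=> [_ qy]; split=> //; rewrite /= /psi big_seq big1// => H HZ.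
  rewrite (hformP y (hH _ (Zsub _ HZ))).1 ?mulr0//.
  by move: HZ; rewrite mem_filter => /andP[/asboolP Hq Hs]; exact: (qy H Hs Hq).
rewrite /= /psi big_seq => /eqP; rewrite psumr_eq0; last first.
  by move=> H /Zsub/py[].
move=> /allP h; split=> //; split=> // H Hs Hq.
have HZ : H \in Z by rewrite mem_filter Hs andbT; exact/asboolP.
have := h _ HZ; rewrite HZ/= mulf_eq0 => h0; apply/(hformP _ (hH _ Hs)).
have [_ p0] := py _ Hs.
by case/orP: h0 => /eqP; [move/p0|].
Qed.

Lemma count_sub_eq (T : eqType) (P Q : pred T) (s : seq T) :
  (forall x : T, x \in s -> P x -> Q x) -> (count Q s <= count P s)%N ->
  forall x : T, x \in s -> Q x -> P x.
Proof.
move=> PQ le x xs Qx; apply: contraT => Px.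
have : (count P s < count Q s)%N.
  rewrite -(@eq_in_count _ (predI P Q)) => [|y ys]; last first.
    by apply: andb_idr; exact: PQ.
  elim: s xs {PQ le} => //= y s IH; rewrite inE => /orP[/eqP <-|/IH].
    rewrite Qx (negPf Px) /= add0n ltnS; apply: sub_count => z /= /andP[_ ->//].
  by move=> h; rewrite -addnS leq_add//; case: (P y) (Q y) => [] [].
by rewrite ltnNge le.
Qed.

(** A face is the cell of any of its points [q] lying on as few hyperplanes as
    possible: by minimality, the midpoint of [q] and another point [y] of the
    face lies on the same hyperplanes as [q], hence so does [y].  Conversely a
    supporting functional that is maximal at the relative interior point [q] is
    constant on the cell of [q]. *)
Lemma is_face_pcell_ex hs p F : hyps hs -> is_face (pcell hs p) F ->
  exists2 q, pcell hs p q & F = pcell hs q.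
Proof.
move=> hH [[q0 Fq0] [a [b [Pb FE]]]].
pose cnt q := count (fun H => `[< H q >]) hs.
have [q Fq qmin] : exists2 q, F q & forall y, F y -> (cnt q <= cnt y)%N.
  have ex : exists n, `[< exists2 q, F q & cnt q = n >].
    by exists (cnt q0); apply/asboolP; exists q0.
  case: (ex_minnP ex) => n /asboolP[q Fq <-] nmin.
  by exists q => // y Fy; apply: nmin; apply/asboolP; exists y.
have pq : pcell hs p q by move: Fq; rewrite FE => -[].
exists q => //.
have aq : dotv a q = b by move: Fq; rewrite FE => -[].
have Fflat : F `<=` pflat hs q.
  move=> y Fy; have [py ay] : pcell hs p y /\ dotv a y = b.
    by move: Fy; rewrite FE.
  pose m := q + 2^-1 *: (y - q).
  have Fm : F m.
    rewrite FE; split; first by apply: pcell_convex => //; lra.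
    by rewrite /= /m !dotvE aq ay; lra.
  have zm H : H \in hs -> H m -> H q /\ H y.
    move=> Hs; have hyH := hH _ Hs; move=> /(hformP _ hyH).
    rewrite /m hform_line => hm; have [h1 h2] := pq _ Hs; have [h3 h4] := py _ Hs.
    have [p0|p0] := eqVneq (hform H p) 0.
      by split; apply/(hformP _ hyH); auto.
    have e1 : hform H p * hform H q = 0.
      have := congr1 ( *%R (hform H p)) hm; rewrite /= mulr0; lra.
    have e2 : hform H p * hform H y = 0.
      have := congr1 ( *%R (hform H p)) hm; rewrite /= mulr0; lra.
    move: e1 e2 => /eqP; rewrite mulf_eq0 (negPf p0) /= => /eqP e1.
    move=> /eqP; rewrite mulf_eq0 (negPf p0) /= => /eqP e2.
    by split; apply/(hformP _ hyH).
  split=> // H Hs Hq; apply: (zm H Hs _).2; apply: contrapT => nHm.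
  have := qmin _ Fm; rewrite leqNgt => /negP; apply.
  exfalso; apply: nHm; apply/asboolP.
  apply: (count_sub_eq (P := fun H => `[< H m >])
    (Q := fun H => `[< H q >]) _ (qmin _ Fm) Hs).
    by move=> K Ks /asboolP Km; apply/asboolP; exact: (zm _ Ks Km).1.
  exact/asboolP.
rewrite FE; apply/seteqP; split=> y.
  by move=> [py ay]; rewrite (pcell_face hH pq); split=> //; apply: Fflat; rewrite FE.
move=> qy; have py := pcell_trans pq qy; split=> //=.
have [e e0 He] := pcell_reflect hH (pcell_flat hH qy).
have h1 := Pb _ (pcell_trans pq He); have h2 := Pb _ py.
move: h1; rewrite dotvBr dotvZr dotvBr aq => h1; apply/eqP; rewrite eq_le h2/=.
have : 0 <= e * (dotv a y - b) by lra.
by rewrite pmulr_rge0// subr_ge0.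
Qed.

Lemma faces_pcell hs p k : hyps hs -> faces k (pcell hs p) =
  [set F | exists q, [/\ pcell hs p q, affdim (pflat hs q) = k & F = pcell hs q]].
Proof.
move=> hH; apply/seteqP; split=> F.
  move=> [/(is_face_pcell_ex hH)[q pq ->] qk]; exists q; split=> //.
  by rewrite -affdim_pcell.
move=> [q [pq qk ->]]; split; first exact: is_face_pcell.
by rewrite affdim_pcell.
Qed.

(** * Chambers *)

Lemma line_continuous y u : continuous (fun e : R => y + e *: u).
Proof.
move=> e; apply: (@continuousD _ _ _ (fun=> y) (fun e => e *: u)).
  exact: cst_continuous.
exact: scalel_continuous.
Qed.

Lemma nbhs_line y u (B : set V) : nbhs y B ->
  exists2 e : R, 0 < e <= 1 & B (y + e *: u).
Proof.
move=> yB; have : nbhs (0 : R) ((fun e : R => y + e *: u) @^-1` B).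
  by apply: line_continuous; rewrite scale0r addr0.
move=> /nbhs_ballP[e /= e0 he]; exists (Num.min (e / 2) 1).
  by rewrite lt_min divr_gt0//= ltr01 ge_min lexx orbT.
apply: he; rewrite /ball/= sub0r normrN ger0_norm; last first.
  by rewrite le_min ler01 divr_ge0// ltW.
by rewrite gt_min; apply/orP; left; rewrite ltr_pdivrMr//; lra.
Qed.

Lemma closed_halfspace a c : closed [set y | dotv a y <= c].
Proof.
have : closed (dotv a @^-1` [set r : R | r <= c]); last exact.
by apply: closed_comp => [y _|]; [exact: dotv_continuous|exact: closed_le].
Qed.

(** A cell is the intersection of all half-spaces that contain it; in this form
    its preimages under maps that have an adjoint are visibly closed. *)
Lemma pcell_halfspaces hs q y :
  (forall a c, (forall z, pcell hs q z -> dotv a z <= c) -> dotv a y <= c) ->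
  pcell hs q y.
Proof.
move=> h H Hs; split.
  suff : dotv (- hform H q *: hvec H) y <= - hform H q * hoff H.
    by rewrite dotvZl /(hform H y); lra.
  by apply: h => z /(_ _ Hs)[]; rewrite dotvZl /(hform H z); lra.
move=> q0; apply/eqP; rewrite eq_le /hform subr_le0 subr_ge0; apply/andP; split.
  by apply: h => z /(_ _ Hs)[_ /(_ q0)]; rewrite /hform; lra.
rewrite -lerN2 -dotvNl; apply: h => z /(_ _ Hs)[_ /(_ q0)].
by rewrite dotvNl /hform; lra.
Qed.

Lemma pcell_comp_closed hs q (f : V -> V) :
  (forall a, exists a' c, forall x, dotv a (f x) = dotv a' x + c) ->
  closed [set x | pcell hs q (f x)].
Proof.
move=> hf; have -> : [set x | pcell hs q (f x)] =
    \bigcap_(ac in [set ac : V * R | forall z, pcell hs q z -> dotv ac.1 z <= ac.2])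
      [set x | dotv ac.1 (f x) <= ac.2].
  apply/seteqP; split=> x qx; first by move=> ac /=; apply.
  by apply: pcell_halfspaces => a c h; exact: (qx (a, c)).
apply: closed_bigI => -[a c] _ /=; have [a' [c' E]] := hf a.
rewrite (_ : [set x | _] = [set x | dotv a' x <= c - c']).
  exact: closed_halfspace.
by apply/seteqP; split=> x /=; rewrite E; lra.
Qed.

Lemma pcell_closed hs q : closed (pcell hs q).
Proof.
by apply: (@pcell_comp_closed hs q id) => a; exists a, 0 => x; rewrite addr0.
Qed.

Definition off_hyps hs q := forall H, H \in hs -> hform H q != 0.

Lemma complementE A : is_arrangement A ->
  complement_of A = off_hyps (enum_fset A).
Proof.
move=> hA; apply/seteqP; split=> y.
  move=> h H HA; apply/eqP => /(hformP _ (hA _ HA)) Hy.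
  by apply: h; exists H.
by move=> h [H /= HA] /(hformP _ (hA _ HA)) /eqP; apply/negP/h.
Qed.

(** The sign of a form cannot change on a connected set avoiding its zeros, and
    conversely points with the same signs are joined by a segment. *)
Lemma component_pcell A p : is_arrangement A -> complement_of A p ->
  connected_component (complement_of A) p =
  complement_of A `&` pcell (enum_fset A) p.
Proof.
move=> hA; set O := complement_of A => Op.
apply/seteqP; split=> y.
  move=> py; have Oy : O y by exact: connected_component_sub py.
  have [off1 off2] : off_hyps (enum_fset A) p /\ off_hyps (enum_fset A) y.
    by rewrite -complementE.
  split=> // H HA; split; last by move/eqP; rewrite (negPf (off1 _ HA)).
  rewrite leNgt; apply/negP => neg.
  pose I := [set hform H x | x in connected_component O p].
  have cI : connected I.
    apply: connected_continuous_connected; first exact: component_connected.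
    by apply: continuous_subspaceT; exact: hform_continuous.
  have Ip : I (hform H p) by exists p => //; exact: connected_component_refl.
  have Iy : I (hform H y) by exists y.
  have : I 0.
    have iI := (connected_intervalP _).1 cI.
    have [p0|p0] := leP 0 (hform H p); [apply: iI Iy Ip _ _|apply: iI Ip Iy _ _];
      apply/andP; split; nra.
  move=> [z pz z0]; have := connected_component_sub pz.
  by rewrite /O complementE// => /(_ _ HA); rewrite z0 eqxx.
move=> [Oy py]; pose I := [set p + e *: (y - p) | e in `[0%R, 1%R]].
have Isub : I `<=` O.
  move=> z [e /= + <-]; rewrite in_itv/= => e01; rewrite /O complementE// => H HA.
  have := Op; have := Oy; rewrite /O complementE// => /(_ _ HA) hy /(_ _ HA) hp.
  have [h1 _] := py _ HA.
  rewrite hform_line; apply/eqP => h.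
  have : (1 - e) * (hform H p * hform H p) + e * (hform H p * hform H y) = 0.
    by have := congr1 ( *%R (hform H p)) h; rewrite /= mulr0; lra.
  have : 0 < hform H p * hform H p by rewrite -expr2 lt_def sqr_ge0 expf_neq0.
  have : 0 < hform H p * hform H y by rewrite lt_def h1 mulf_neq0.
  nra.
have cI : connected I.
  apply: connected_continuous_connected; first exact: segment_connected.
  by apply: continuous_subspaceT; exact: line_continuous.
apply: (connected_component_max _ Isub cI).
  by exists 0; rewrite ?scale0r ?addr0//= in_itv/= lexx ler01.
by exists 1; rewrite ?scale1r ?[p + _]addrC ?subrK//= in_itv/= lexx ler01.
Qed.

(** A point [y] of the closed cell is approached along the segment towards the
    interior point [p]. *)
Lemma closure_component A p : is_arrangement A -> complement_of A p ->
  closure (connected_component (complement_of A) p) = pcell (enum_fset A) p.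
Proof.
move=> hA Op; rewrite component_pcell//; apply/seteqP; split.
  apply: (@subset_trans _ (closure (pcell (enum_fset A) p))).
    by apply: closure_subset; exact: subIsetr.
  by rewrite -(closure_id _).1//; exact: pcell_closed.
move=> y py B /(nbhs_line (p - y))[e /andP[e0 e1] Be].
exists (y + e *: (p - y)); split=> //; split; last first.
  by apply: pcell_convex => //; [exact: pcell_self|rewrite ltW].
rewrite complementE// => H HA; have [h1 _] := py _ HA.
have := Op; rewrite complementE// => /(_ _ HA) hp.
rewrite hform_line; apply/eqP => h.
have : (1 - e) * (hform H p * hform H y) + e * (hform H p * hform H p) = 0.
  by have := congr1 ( *%R (hform H p)) h; rewrite /= mulr0; lra.
have : 0 < hform H p * hform H p by rewrite -expr2 lt_def sqr_ge0 expf_neq0.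
nra.
Qed.

Lemma chambersE A : is_arrangement A ->
  chambers A = [set pcell (enum_fset A) p | p in complement_of A].
Proof.
move=> hA; apply/seteqP; split=> _ [p Op <-]; exists p => //.
  by rewrite closure_component.
by rewrite closure_component.
Qed.

(** * Faces of chambers *)

Lemma near_off_hyps hs y : off_hyps hs y -> nbhs y (off_hyps hs).
Proof.
elim: hs => [|H hs IH] oy; first by apply: filterS filterT => z _ K.
have {}IH : nbhs y (off_hyps hs).
  by apply: IH => K Ks; apply: oy; rewrite inE Ks orbT.
have Hy : nbhs y [set z | hform H z != 0].
  apply: (@hform_continuous _ _ H y [set c | c != 0]).
  apply: open_nbhs_nbhs; split; first exact: open_neq.
  by apply: oy; rewrite mem_head.
by apply: filterS2 Hy IH => z hz oz K; rewrite inE => /orP[/eqP ->|/oz].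
Qed.

(** Finitely many hyperplanes do not fill a neighbourhood: one is left at a time,
    in the direction of its normal vector, by a move so small that those already
    avoided stay avoided. *)
Lemma nbhs_avoid hs x (N : set V) : hyps hs -> nbhs x N ->
  exists2 y, N y & off_hyps hs y.
Proof.
move=> hH xN; suff [y yN oy] : exists2 y, nbhs y N & off_hyps hs y.
  by exists y => //; exact: nbhs_singleton.
elim: hs hH => [|H hs IH] hH; first by exists x.
have [hyH hyhs] := hyps_cons hH; have [y yN oy] := IH hyhs.
have [y0|y0] := eqVneq (hform H y) 0; last first.
  by exists y => // K; rewrite inE => /orP[/eqP ->|/oy].
have [e /andP[e0 _] [Ne oe]] :=
  nbhs_line (hvec H) (filterI (nbhs_interior yN) (near_off_hyps oy)).
exists (y + e *: hvec H) => // K; rewrite inE => /orP[/eqP ->|/oe//].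
rewrite hformD y0 add0r dotvZr mulf_neq0 ?dotv_eq0 ?hvec_neq0//.
by rewrite gt_eqF.
Qed.

(** A point off the hyperplanes and so close to [q] that the nonzero signs at [q]
    are preserved. *)
Lemma chamber_ex A q : is_arrangement A ->
  exists2 p, complement_of A p & pcell (enum_fset A) p q.
Proof.
move=> hA.
have : nbhs q [set y | forall H, H \in enum_fset A -> hform H q != 0 ->
    0 < hform H q * hform H y].
  elim: (enum_fset A) => [|H hs IH]; first by apply: filterS filterT => z _ K.
  have Hq : nbhs q [set y | hform H q != 0 -> 0 < hform H q * hform H y].
    have [->|q0] := eqVneq (hform H q) 0; first by apply: filterS filterT.
    apply: (@filterS _ _ _ [set y | 0 < hform H q * hform H y]); first by move=> y ? _.
    apply: open_nbhs_nbhs; split=> /=; last first.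
      by rewrite -expr2 lt_def sqr_ge0 expf_neq0.
    have -> : [set y | 0 < hform H q * hform H y] =
        ~` [set y | dotv (hform H q *: hvec H) y <= hform H q * hoff H].
      apply/seteqP; split=> y /=; rewrite dotvZl /(hform H y).
        by move=> h; apply/negP; rewrite -ltNge; lra.
      by move=> /negP; rewrite -ltNge; lra.
    by apply: closed_openC; exact: closed_halfspace.
  by apply: filterS2 Hq IH => z hz oz K; rewrite inE => /orP[/eqP ->|/oz].
move=> /(@nbhs_avoid (enum_fset A)) [|p hp op]; first exact: hA.
exists p; first by rewrite complementE.
move=> H HA; split; last by move/eqP; rewrite (negPf (op _ HA)).
have [->|q0] := eqVneq (hform H q) 0; first by rewrite mulr0.
by rewrite mulrC ltW// hp.
Qed.

Lemma chamber_facesE A j : is_arrangement A -> chamber_faces A j =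
  [set P | exists2 q, affdim (pflat (enum_fset A) q) = j & P = pcell (enum_fset A) q].
Proof.
move=> hA; have hH : hyps (enum_fset A) by exact: hA.
rewrite /chamber_faces chambersE//; apply/seteqP; split=> P.
  move=> [_ [p Op <-]]; rewrite faces_pcell// => -[q [pq qj ->]].
  by exists q.
move=> [q qj ->]; have [p Op pq] := chamber_ex q hA.
exists (pcell (enum_fset A) p); first by exists p.
by rewrite faces_pcell//; exists q.
Qed.

(** * Cells listed by flats and sign vectors *)

Lemma ccellP L hs t p y : size t = size hs -> ocell L hs t p ->
  ccell L hs t y <-> L y /\ forall H, H \in hs -> 0 <= hform H p * hform H y.
Proof.
elim: hs t => [|H hs IH] [|b t]//=; first by move=> _ _; split=> [Ly|[]].
move=> [st] [op hp]; have {}IH := IH _ st op.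
have same : (0 <= sg R b * hform H y) = (0 <= hform H p * hform H y).
  rewrite /= in hp; rewrite -(pmulr_rge0 (sg R b * hform H y) hp).
  rewrite mulrACA pmulr_rge0// -expr2 lt_def sqr_ge0 andbT.
  by rewrite expf_neq0// sg_neq0.
split=> [[/IH[Ly h] /= hy]|[Ly h]].
  by split=> // K; rewrite inE => /orP[/eqP ->|/h//]; rewrite -same.
split; last by rewrite /= same h ?mem_head.
by apply/IH; split=> // K Ks; apply: h; rewrite inE Ks orbT.
Qed.

Lemma ocell_signs L hs t p : ocell L hs t p -> size t = size hs ->
  t = [seq 0 < hform H p | H <- hs].
Proof.
elim: hs t => [|H hs IH] [|b t]//= [op hp] [st].
rewrite -(IH t)//; congr (_ :: _); move: hp; rewrite /= /sg.
by case: b; rewrite ?mul1r ?mulN1r ?oppr_gt0 => h; rewrite ?h// ltNge ltW.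
Qed.

Lemma ocell_off L hs t p H : ocell L hs t p -> size t = size hs -> H \in hs ->
  hform H p != 0.
Proof.
elim: hs t => [|K hs IH] [|b t]//= [op hp] [st]; rewrite inE => /orP[/eqP ->|].
  by apply: contraTneq hp => h; rewrite /= h mulr0 ltxx.
exact: IH op st.
Qed.

(** The dictionary between the two descriptions of cells: by a flat with a sign
    list, and by a point of the open cell. *)
Lemma ocell_flat A L t p : is_arrangement A -> L \in flats A ->
  size t = size (crossing A L) -> ocell L (crossing A L) t p ->
  pflat (enum_fset A) p = L /\ ccell L (crossing A L) t = pcell (enum_fset A) p.
Proof.
move=> hA LA st op; have [_ _ Lh] := flats_prop hA LA.
have Lp : L p by exact: ccell_sub (ocell_ccell op).
have cr H : H \in A -> ~ L `<=` H -> H \in crossing A L.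
  by move=> HA nLH; rewrite mem_filter HA andbT; apply/asboolP.
have Hp H : H \in A -> H p -> L `<=` H.
  move=> HA /(hformP _ (hA _ HA)) Hp; apply: contrapT => /(cr _ HA) Hc.
  by have := ocell_off op st Hc; rewrite Hp eqxx.
have pL : pflat (enum_fset A) p = L.
  apply/seteqP; split=> y.
    by move=> [_ yp]; apply: Lh => H HA LH; apply: yp => //; exact: LH.
  by move=> Ly; split=> // H HA /(Hp _ HA); exact.
split=> //; apply/seteqP; split=> y.
  move=> /(ccellP _ st op)[Ly h] H HA; have hyH := hA _ HA.
  have [Hc|Hc] := boolP (H \in crossing A L).
    split; first exact: h.
    by move/eqP; rewrite (negPf (ocell_off op st Hc)).
  have LH : L `<=` H by apply: contrapT => /(cr _ HA); exact/negP.
  by rewrite (hformP y hyH).1 ?mulr0//; exact: LH.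
move=> py; apply/(ccellP _ st op); split.
  by rewrite -pL; apply: pcell_flat py => H /hA.
by move=> H /crossing_sub /py[].
Qed.

Definition cell_index A j : seq (set V * seq bool) :=
  [seq i <- [seq (L, t) | L <- enum_fset (flats_dim A j),
                            t <- signs (size (crossing A L))] |
   `[< ocell i.1 (crossing A i.1) i.2 !=set0 >]].

Definition cell_list A j : seq (set V) :=
  [seq ccell i.1 (crossing A i.1) i.2 | i <- cell_index A j].

Lemma cell_indexP A j L t : reflect
  [/\ L \in flats A, affdim L = j, size t = size (crossing A L) &
      ocell L (crossing A L) t !=set0]
  ((L, t) \in cell_index A j).
Proof.
rewrite mem_filter; apply: (iffP andP) => /=.
  move=> [/asboolP ne /allpairsPdep[L' [t' [+ + [LE tE]]]]]; rewrite -LE -tE.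
  by rewrite inE mem_signs => /andP[LA /eqP Lj] /eqP st; rewrite /= in ne; split.
move=> [LA Lj st ne]; split; first exact/asboolP.
apply/allpairsPdep; exists L, t; split=> //; last by rewrite mem_signs; apply/eqP.
by rewrite inE; apply/andP; split; [exact: LA|exact/eqP].
Qed.

Lemma cell_list_uniq A j : is_arrangement A -> uniq (cell_list A j).
Proof.
move=> hA; rewrite map_inj_in_uniq.
  apply: filter_uniq; apply: allpairs_uniq_dep.
  - exact: fset_uniq.
  - by move=> L _; exact: signs_uniq.
  - by move=> [L t] [L' t'] _ _ /= [-> ->].
move=> [L t] [L' t'] /cell_indexP[LA _ st [p op]].
move=> /cell_indexP[LA' _ st' [p' op']] /= e.
have [pL pc] := ocell_flat hA LA st op; have [pL' pc'] := ocell_flat hA LA' st' op'.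
have e' : pcell (enum_fset A) p = pcell (enum_fset A) p' by rewrite -pc -pc'.
have LL : L = L' by rewrite -pL -pL'; exact: pcell_inj_flat e'.
move: LL st' op' e => <- st' op' _; congr (_, _).
rewrite (ocell_signs op st) (ocell_signs op' st').
apply/eq_in_map => H Hc; have HA := crossing_sub Hc.
have h := ocell_off op st Hc; have h' := ocell_off op' st' Hc.
have : pcell (enum_fset A) p p' by rewrite e'; exact: pcell_self.
move=> /(_ _ HA)[hh _].
have {hh} : 0 < hform H p * hform H p' by rewrite lt_def mulf_neq0.
case: (ltP 0 (hform H p)) => hp; first by rewrite pmulr_rgt0// => ->.
have hn : hform H p < 0 by rewrite lt_neqAle h.
by rewrite (nmulr_rgt0 _ hn) => hp'; rewrite ltNge ltW.
Qed.

Lemma cell_listE A j : is_arrangement A ->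
  chamber_faces A j = [set` cell_list A j].
Proof.
move=> hA; have hH : hyps (enum_fset A) by exact: hA.
rewrite chamber_facesE//; apply/seteqP; split=> P /=.
  move=> [q qj ->]; set L := pflat (enum_fset A) q.
  have LA : L \in flats A.
    rewrite inE; apply/andP; split; last by apply/set0P; exists q; exact: pflat_self.
    apply/imfsetP; exists [fset H in A | `[< H q >]] => /=.
      by rewrite fpowersetE; apply/fsubsetP => H; rewrite !inE => /andP[HA _]; exact: HA.
    apply/seteqP; split=> y [_ yq]; split=> // H /=.
      by rewrite !inE => /andP[HA /asboolP]; exact: yq.
    by move=> HA Hq; apply: yq; rewrite /= !inE HA/=; exact/asboolP.
  pose t := [seq 0 < hform H q | H <- crossing A L].
  have st : size t = size (crossing A L) by rewrite size_map.
  have oq : ocell L (crossing A L) t q.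
    have off H : H \in crossing A L -> hform H q != 0.
      rewrite mem_filter => /andP[/asboolP LH HA]; apply/eqP => Hq; apply: LH.
      by move=> y [_]; apply => //; apply/(hformP _ (hA _ HA)).
    rewrite /t; elim: (crossing A L) off => [_|H hs IH off] /=; first exact: pflat_self.
    split; first by apply: IH => K Ks; apply: off; rewrite inE Ks orbT.
    have := off _ (mem_head _ _) => h; rewrite /= /sg; case: (ltP 0 (hform H q)) => hq.
      by rewrite mul1r.
    by rewrite mulN1r oppr_gt0 lt_neqAle h hq.
  apply/mapP; exists (L, t); first by apply/cell_indexP; split=> //; exists q.
  by have [_ ->] := ocell_flat hA LA st oq.
move=> /mapP[[L t] /cell_indexP[LA Lj st [p op]] ->].
by have [pL pc] := ocell_flat hA LA st op; exists p; rewrite ?pL.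
Qed.

Lemma sum_cells A j (M : nmodType) (G : set V -> M) : is_arrangement A ->
  \sum_(P \in chamber_faces A j) G P =
  \sum_(L <- flats_dim A j) \sum_(t <- signs (size (crossing A L)) |
      `[< ocell L (crossing A L) t !=set0 >]) G (ccell L (crossing A L) t).
Proof.
move=> hA; rewrite cell_listE// -fsbig_seq ?cell_list_uniq//.
rewrite big_map big_filter big_mkcond big_allpairs_dep /=.
by apply: eq_bigr => L _; rewrite [RHS]big_mkcond.
Qed.

End PointCells.

(** * Normal cones and metric projections *)

Section NormalCones.
Variables (R : realType) (d : nat).
Local Notation V := 'rV[R]_d.
Implicit Types (a x y z u v p q r f : V) (c e s : R) (U W : {vspace V}).
Implicit Types (S C L H P F : set V) (hs T : seq (set V)) (t : seq bool).
Implicit Types (A B : {fset set V}).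

Lemma pcell_eq hs p q : pcell hs p q -> pcell hs q p -> pcell hs p = pcell hs q.
Proof.
by move=> pq qp; apply/seteqP; split=> y; exact: pcell_trans.
Qed.

(** A face of the cell of [q] that contains [q] is the whole cell. *)
Lemma relint_pcell hs q : hyps hs -> relint (pcell hs q) q.
Proof.
move=> hH; split=> [|G]; first exact: pcell_self.
move=> /(is_face_pcell_ex hH)[r qr ->] + rq.
by rewrite (pcell_eq qr rq) ltnn.
Qed.

(** The functional [z] is bounded above on the cell of [p] by its value at the
    relative interior point [q] of the face, hence constant on the face. *)
Lemma normal_cone_pcell hs p q z : hyps hs -> pcell hs p q ->
  normal_cone (pcell hs q) (pcell hs p) z <->
  forall y, pcell hs p y -> dotv z (y - q) <= 0.
Proof.
move=> hH pq; split=> [h y py|h u [f [qf _] [e [e0 pe]]]].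
  apply: h; exists q; first exact: relint_pcell.
  by exists 1; rewrite scale1r addrC subrK; split.
have zf : dotv z (f - q) = 0.
  apply/eqP; rewrite eq_le h/=; last exact: pcell_trans qf.
  have [e' e'0 qe] := pcell_reflect hH (pcell_flat hH qf).
  have := h _ (pcell_trans pq qe).
  by rewrite addrAC subrr add0r dotvNr oppr_le0 dotvZr pmulr_rge0.
have := h _ pe; rewrite addrAC dotvDr zf add0r dotvZr.
by rewrite pmulr_rle0.
Qed.

Lemma normal_cone_orth hs p q z u : hyps hs -> pcell hs p q ->
  (forall y, pcell hs p y -> dotv z (y - q) <= 0) ->
  pflat hs q u -> dotv z (u - q) = 0.
Proof.
move=> hH pq h qu; apply/eqP; rewrite eq_le; apply/andP; split.
  have [e e0 He] := pcell_near hH qu.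
  have qe : pcell hs q (q + e *: (u - q)) by apply: He; rewrite lexx ltW.
  have := h _ (pcell_trans pq qe).
  by rewrite addrAC subrr add0r dotvZr pmulr_rle0.
have [e e0 qe] := pcell_reflect hH qu.
have := h _ (pcell_trans pq qe).
by rewrite addrAC subrr add0r dotvNr oppr_le0 dotvZr pmulr_rge0.
Qed.

Lemma mem_minkowski hs p q x : hyps hs -> pcell hs p q ->
  minkowski_sum (pcell hs q) (normal_cone (pcell hs q) (pcell hs p)) x <->
  exists f, [/\ pcell hs q f, nearest (pflat hs q) x f &
                forall y, pcell hs p y -> dotv (x - f) (y - q) <= 0].
Proof.
move=> hH pq; split=> [[f qf [z zN <-]]|[f [qf nf fN]]].
  move/(normal_cone_pcell _ hH pq) in zN.
  have zE : f + z - f = z by rewrite addrAC subrr add0r.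
  exists f; rewrite zE; split=> //; split; first exact: pcell_flat.
  move=> y qy; rewrite zE.
  have -> : y - f = (y - q) - (f - q) by rewrite opprB addrA subrK.
  rewrite dotvBr (normal_cone_orth hH pq zN qy).
  by rewrite (normal_cone_orth hH pq zN (pcell_flat hH qf)) subrr.
exists f => //; exists (x - f); last by rewrite addrC subrK.
exact/(normal_cone_pcell _ hH pq).
Qed.

Lemma minkowski_nearest hs p q x f : hyps hs -> pcell hs p q ->
  pcell hs q f -> (forall y, pcell hs p y -> dotv (x - f) (y - q) <= 0) ->
  nearest (pcell hs p) x f.
Proof.
move=> hH pq qf fN; split; first exact: pcell_trans qf.
move=> y py; have -> : y - f = (y - q) - (f - q) by rewrite opprB addrA subrK.
by rewrite dotvBr (normal_cone_orth hH pq fN (pcell_flat hH qf)) subr0 fN.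
Qed.

(** A decomposition of [x] in F + N_F(P), with F the cell of [q], exhibits [f] as
    the projection of [x] to the affine hull of F; by general position [f] then
    lies only on the hyperplanes containing F. *)
Lemma minkowski_generic hs p q x f : hyps hs -> genpos hs setT x ->
  pcell hs p q -> nearest (pcell hs p) x f ->
  minkowski_sum (pcell hs q) (normal_cone (pcell hs q) (pcell hs p)) x <->
  pcell hs q = pcell hs f.
Proof.
move=> hH g pq nf; split=> [/(mem_minkowski _ hH pq)[f' [qf' nf' fN]]|qf].
  have ff : f' = f := nearest_uniq (minkowski_nearest hH pq qf' fN) nf.
  subst f'; have pf : pcell hs p f by case: nf.
  rewrite (pcell_face hH pq) (pcell_face hH pf); congr (_ `&` _).
  have same H : H \in hs -> H f -> H q.
    move=> Hs Hf; move: nf'; rewrite /pflat face_flatE => nf'.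
    apply: (g _ _ _ nf' _ Hs Hf); first by move=> K; rewrite mem_filter => /andP[].
    by rewrite -face_flatE; exact: pflat_self.
  have same' H : H \in hs -> H q -> H f.
    by move=> Hs Hq; have [_] := pcell_flat hH qf'; apply.
  apply/seteqP; split=> y [_ h]; split=> // H Hs Hx; apply: h => //.
    exact: same.
  exact: same'.
apply/(mem_minkowski _ hH pq); exists f.
have pf : pcell hs p f by case: nf.
have nf' : forall y, pcell hs p y -> dotv (x - f) (y - f) <= 0 by case: nf.
have fl : pflat hs q = pflat hs f by exact: pcell_inj_flat.
split; first by rewrite qf; exact: pcell_self.
  rewrite fl; split; first exact: pflat_self.
  by move=> y fy; rewrite (normal_cone_orth hH pf nf' fy) lexx.
move=> y py; have -> : y - q = (y - f) - (q - f) by rewrite opprB addrA subrK.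
have nq : dotv (x - f) (q - f) = 0.
  by apply: (normal_cone_orth hH pf nf'); rewrite -fl; exact: pflat_self.
by rewrite dotvBr nq subr0 nf'.
Qed.

Lemma nearest_pcell_ex A p x : is_arrangement A ->
  exists f, nearest (pcell (enum_fset A) p) x f.
Proof.
move=> hA; have hH : hyps (enum_fset A) by exact: hA.
set hs := enum_fset A.
have : chamber_faces A (affdim (pflat hs p)) (pcell hs p).
  by rewrite chamber_facesE//; exists p.
rewrite cell_listE// => /mapP[[L t] /cell_indexP[LA _ _ [r /ocell_ccell rL]] ->].
apply: nearest_exists; last by exists r.
- exact: hyps_crossing.
- by have [] := flats_prop hA LA.
Qed.

(** The point of [P] nearest to [x] lies in the relative interior of a face of
    dimension [k]. *)
Definition lands hs k x P : bool :=
  `[< exists2 f, nearest P x f & affdim (pflat hs f) = k >].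

(** Only the face carrying the nearest point in its relative interior
    contributes. *)
Lemma sum_faces A k x p : is_arrangement A -> genpos (enum_fset A) setT x ->
  \sum_(F \in faces k (pcell (enum_fset A) p))
     (\1_(minkowski_sum F (normal_cone F (pcell (enum_fset A) p))) x : int) =
  (lands (enum_fset A) k x (pcell (enum_fset A) p))%:R.
Proof.
move=> hA; set hs := enum_fset A => g; have hH : hyps hs by exact: hA.
have [f nf] := nearest_pcell_ex p x hA.
have pf : pcell hs p f by case: nf.
rewrite faces_pcell//.
have [fk|fk] := eqVneq (affdim (pflat hs f)) k.
  rewrite (_ : lands hs k x _ = true); last by apply/asboolP; exists f.
  rewrite -(@fsbig_widen _ _ _ _ [set pcell hs f]).
  - rewrite fsbig_set1 indicE mem_set//.
    exact/(minkowski_generic hH g pf nf).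
  - by move=> _ ->; exists f.
  - move=> F [[q [pq qk ->]] /= qf]; rewrite indicE memNset//.
    by move/(minkowski_generic hH g pq nf).
rewrite (_ : lands hs k x _ = false); last first.
  apply/asboolP => -[f' nf' f'k]; move: fk.
  by rewrite (nearest_uniq nf nf') f'k eqxx.
apply: fsbig1 => F [q [pq qk ->]]; rewrite indicE memNset//.
move=> /(minkowski_generic hH g pq nf) /(pcell_inj_flat hH) e.
by rewrite -e qk eqxx in fk.
Qed.

Lemma sum_chamber_faces A k j x : is_arrangement A ->
  genpos (enum_fset A) setT x ->
  \sum_(P \in chamber_faces A j) \sum_(F \in faces k P)
     (\1_(minkowski_sum F (normal_cone F P)) x : int) =
  \sum_(L <- flats_dim A j) (hits (crossing A L) L k x)%:R.
Proof.
move=> hA g.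
rewrite (eq_fsbigr (fun P => (lands (enum_fset A) k x P)%:R)); last first.
  move=> P; rewrite chamber_facesE// inE => -[q _ ->].
  exact: sum_faces.
rewrite sum_cells// big_seq [RHS]big_seq; apply: eq_bigr => L.
rewrite inE => /andP[LA _]; have [aL _ _] := flats_prop hA LA.
rewrite /hits natr_sum big_mkcond big_seq [RHS]big_seq; apply: eq_bigr => t.
rewrite mem_signs => /eqP st; case: asboolP => [ne|ne]; last by rewrite hit0.
congr (nat_of_bool _)%:R; have [p op] := ne.
have [f nf] : exists f, nearest (ccell L (crossing A L) t) x f.
  apply: nearest_exists => //; first exact: hyps_crossing.
  by exists p; exact: ocell_ccell.
rewrite (hitE k ne nf).
have Lf : L f by case: nf => /ccell_sub.
have -> : face_flat L (crossing A L) f = pflat (enum_fset A) f.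
  have [_ _ Lh] := flats_prop hA LA.
  apply/seteqP; split=> y.
    move=> [Ly fy]; split=> // H HA Hf.
    have [Hc|Hc] := boolP (H \in crossing A L); first exact: fy.
    move: Hc; rewrite mem_filter HA andbT negbK => /asboolP; exact.
  move=> [_ fy]; split; last by move=> H /crossing_sub; exact: fy.
  by apply: Lh => H HA LH; apply: fy => //; exact: LH.
apply/asboolP/eqP => [[f' nf' <-]|<-]; last by exists f.
by rewrite (nearest_uniq nf nf').
Qed.

(** * Local constancy *)

(** Membership of [x] means that its orthogonal projection [f x] to the affine
    hull of the face lies in the face and that [x - f x] is a normal vector; both
    are systems of weak affine inequalities in [x] because the projection is
    self-adjoint. *)
Lemma minkowski_closed hs p q : hyps hs -> pcell hs p q ->
  closed (minkowski_sum (pcell hs q) (normal_cone (pcell hs q) (pcell hs p))).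
Proof.
move=> hH pq.
have [U UE] := affine_flat (pflat_affine q hH) (pflat_self hs q).
pose f x := q + oproj U (x - q).
have dotf a x : dotv a (f x) = dotv (oproj U a) x + (dotv a q - dotv (oproj U a) q).
  by rewrite /f dotvDr oproj_adj dotvBr; ring.
have -> : minkowski_sum (pcell hs q) (normal_cone (pcell hs q) (pcell hs p)) =
    [set x | pcell hs q (f x)] `&` \bigcap_(y in pcell hs p)
      [set x | dotv (y - q - oproj U (y - q)) x <=
               dotv (y - q - oproj U (y - q)) q].
  have dotN x y : dotv (x - f x) (y - q) =
      dotv (y - q - oproj U (y - q)) x - dotv (y - q - oproj U (y - q)) q.
    rewrite -dotvBr /f opprD addrA; move: (y - q) (x - q) => w v.
    by rewrite !dotvBl -oproj_adj (dotvC w) (dotvC v (oproj U w)).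
  apply/seteqP; split=> x.
    move=> /(mem_minkowski _ hH pq)[f' [qf nf fN]].
    have ff : f' = f x.
      by apply: nearest_uniq nf _; rewrite UE; exact: nearest_oproj.
    subst f'; split=> // y py /=.
    by have := fN _ py; rewrite dotN subr_le0.
  move=> [qf fN]; apply/(mem_minkowski _ hH pq); exists (f x); split=> //.
    by rewrite UE; exact: nearest_oproj.
  by move=> y py; rewrite dotN subr_le0; exact: (fN y py).
apply: closedI.
  apply: pcell_comp_closed => a.
  by exists (oproj U a), (dotv a q - dotv (oproj U a) q).
by apply: closed_bigI => y _; exact: closed_halfspace.
Qed.

Lemma near_bdry S x : closed S -> ~ bdry S x -> nbhs x [set y | S y <-> S x].
Proof.
move=> cS nb; have [Sx|nSx] := pselect (S x).
  have iS : interior S x by apply: contrapT => ni; apply: nb.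
  by apply: filterS iS => y Sy; split.
have : nbhs x (~` S) by apply: open_nbhs_nbhs; split=> //; exact: closed_openC.
by apply: filterS => y Sy; split.
Qed.

Lemma near_mem_seq (T : eqType) (s : seq T) (Q : T -> set V) x :
  (forall i, i \in s -> nbhs x (Q i)) ->
  nbhs x [set y | forall i, i \in s -> Q i y].
Proof.
elim: s => [_|i s IH h]; first by apply: filterS filterT => y _ i.
have h1 := h _ (mem_head _ _).
have h2 : nbhs x [set y | forall i, i \in s -> Q i y].
  by apply: IH => k ks; apply: h; rewrite inE ks orbT.
by apply: filterS2 h1 h2 => y y1 y2 k; rewrite inE => /orP[/eqP ->|/y2].
Qed.

Lemma near_indicators A k j x : is_arrangement A -> ~ exceptional_set A k j x ->
  nbhs x [set y | forall P, chamber_faces A j P -> forall F, faces k P F ->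
    minkowski_sum F (normal_cone F P) y <-> minkowski_sum F (normal_cone F P) x].
Proof.
move=> hA nE; have hH : hyps (enum_fset A) by exact: hA.
have := @near_mem_seq _ [seq (P, F) | P <- cell_list A j, F <- cell_list A k]
  (fun PF => [set y | faces k PF.1 PF.2 ->
     minkowski_sum PF.2 (normal_cone PF.2 PF.1) y <->
     minkowski_sum PF.2 (normal_cone PF.2 PF.1) x]) x.
have sub P F : chamber_faces A j P -> faces k P F -> chamber_faces A k F.
  rewrite !chamber_facesE// => -[p pj ->]; rewrite faces_pcell// => -[q [_ qk ->]].
  by exists q.
move=> h; apply: filterS (h _) => [y hy P Pj F FP|[P F]].
  apply: (hy (P, F)) => //; apply/allpairsP; exists (P, F); split=> //=.
    by move: Pj; rewrite cell_listE.
  by have := sub _ _ Pj FP; rewrite cell_listE.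
move=> /allpairsP[[P' F'] /= [Ps _ [-> ->]]].
have Pj : chamber_faces A j P' by rewrite cell_listE.
have [FP|nFP] := pselect (faces k P' F'); last by apply: filterS filterT.
have [p pE] : exists p, P' = pcell (enum_fset A) p.
  by move: Pj; rewrite chamber_facesE// => -[p _ ->]; exists p.
apply: filterS (near_bdry (S := minkowski_sum F' (normal_cone F' P')) _ _).
- by move=> y hy _; exact: hy.
- move: FP; rewrite pE faces_pcell// => -[q [pq _ ->]].
  exact: minkowski_closed.
- by move=> b; apply: nE; exists P' => //; exists F'.
Qed.

(** * Density of general position *)

Lemma avoid_family (I : eqType) (s : seq I) (Bad : I -> set V) :
  (forall i, i \in s -> Bad i !=set0 ->
     exists2 K, hyperplane K & Bad i `<=` K) ->
  exists2 Ks, hyps Ks & forall y, off_hyps Ks y ->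
    forall i, i \in s -> ~ Bad i y.
Proof.
elim: s => [_|i s IH h]; first by exists [::].
have [k ks|Ks hKs offK] := IH; first by apply: h; rewrite inE ks orbT.
have [ne|ne] := pselect (Bad i !=set0).
  have [K hK iK] := h i (mem_head _ _) ne.
  exists (K :: Ks); first by move=> J; rewrite inE => /orP[/eqP ->|/hKs].
  move=> y oy k; rewrite inE => /orP[/eqP -> /iK /(hformP _ hK)/eqP|].
    by apply/negP; apply: oy; rewrite mem_head.
  by apply: offK => J Js; apply: oy; rewrite inE Js orbT.
exists Ks => // y oy k; rewrite inE => /orP[/eqP -> iy|]; last exact: offK.
by apply: ne; exists y.
Qed.

(** With [w] the projection of the normal vector of [H] to the directions of [L],
    the projection of [x] to [L] lies on [H] only if [dotv w x] has the value it
    takes at a point common to [L] and [H]; and [w] is nonzero as [L] is not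
    contained in [H]. *)
Lemma bad_hyperplane L H : affine_subspace L -> hyperplane H -> ~ L `<=` H ->
  [set x | exists2 q, nearest L x q & H q] !=set0 ->
  exists2 K, hyperplane K & [set x | exists2 q, nearest L x q & H q] `<=` K.
Proof.
move=> aL hH nLH [x0 [p0 [Lp0 _] Hp0]]; have [U LE] := affine_flat aL Lp0.
pose w := oproj U (hvec H).
exists [set x | dotv w x = dotv w p0].
  exists w, (dotv w p0); split=> //; apply/eqP => w0; apply: nLH => y.
  rewrite LE /flat/= => yU; apply/(hformP _ hH).
  rewrite -(subrK p0 y) addrC hformD (hformP p0 hH).1// add0r.
  by have := oproj_orth (hvec H) yU; rewrite -/w w0 subr0.
move=> x [q nq Hq] /=; have qE : q = p0 + oproj U (x - p0).
  by apply: nearest_uniq nq _; rewrite LE; exact: nearest_oproj.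
move/(hformP _ hH): Hq; rewrite qE hformD (hformP p0 hH).1// add0r.
by rewrite oproj_adj -/w dotvBr => /subr0_eq.
Qed.

(** The flats are indexed by the finitely many subfamilies of the arrangement, so
    that finitely many hyperplanes are to be avoided. *)
Lemma genpos_dense A x (N : set V) : is_arrangement A -> nbhs x N ->
  exists2 y, N y & genpos (enum_fset A) setT y.
Proof.
move=> hA xN; have hH : hyps (enum_fset A) by exact: hA.
pose Bad (TH : {fset set V} * set V) : set V := [set x |
  ~ (setT `&` meet (enum_fset TH.1) `<=` TH.2) /\
  exists2 q, nearest (setT `&` meet (enum_fset TH.1)) x q & TH.2 q].
have [|Ks hKs offK] := @avoid_family _
  [seq (B, H) | B <- enum_fset (fpowerset A), H <- enum_fset A] Bad.
  move=> _ /allpairsP[[B H] /= [BA HA ->]] [y /= [nLH [q nq Hq]]].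
  rewrite fpowersetE in BA; have BA' := fsubsetP BA.
  have aL : affine_subspace (setT `&` meet (enum_fset B)).
    apply: affine_capmeet; first by move=> K /BA'/hA.
      exact: affine_setT.
    by exists q; case: nq.
  have [|K hK sub] := bad_hyperplane aL (hA _ HA) nLH.
    by exists y; exists q.
  by exists K => // z [_ /sub].
have [y Ny oy] := nbhs_avoid hKs xN.
exists y => // T Ths q nq H Hs Hq; apply: contrapT => nLH.
pose B := [fset K in T].
have TE : meet T = meet (enum_fset B).
  by apply/seteqP; split=> z h K KT; apply: h; move: KT; rewrite /B !inE.
apply: (offK y oy (B, H)).
  apply/allpairsP; exists (B, H); split=> //=.
  by rewrite fpowersetE; apply/fsubsetP => K; rewrite !inE => /Ths.
by split; rewrite -TE//; exists q.
Qed.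

End NormalCones.

(** * The identity *)

Theorem theorem1p8 (R : realType) (d : nat) (A : {fset set 'rV[R]_d})
  (a : nat -> nat -> int) :
  is_arrangement A ->
  (forall j : nat, (j <= d)%N ->
     level_charpoly A j =
       \sum_(k < j.+1) ((-1) ^+ (j - k) * a k j) *: 'X^k) ->
  forall j k : nat, (j <= d)%N -> (k <= j)%N ->
  forall x : 'rV[R]_d, ~ exceptional_set A k j x ->
    \sum_(P \in chamber_faces A j) \sum_(F \in faces k P)
       (\1_(minkowski_sum F (normal_cone F P)) x : int) = a k j.
Proof.
move=> hA hchi j k jd kj x nE.
have [y yx g] := genpos_dense hA (near_indicators hA nE).
rewrite (level_charpoly_hits hA g kj (hchi j jd)) -sum_chamber_faces//.
apply: eq_fsbigr => P; rewrite inE => Pj.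
apply: eq_fsbigr => F; rewrite inE => FP.
rewrite !indicE; congr (nat_of_bool _)%:R.
by apply/idP/idP; rewrite !inE => /(yx _ Pj _ FP).
Qed.
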